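(* Let $\zeta\in X^1(\mathbb Z)$. For any $p\ge1$, the modified gAL equation $$i\frac{d\phi_n}{dt}+\kappa(\Delta(\phi+\zeta))_n-\mu q_0^{2p}(\phi_n+\zeta_n)+\tfrac12\mu|\phi_n+\zeta_n|^{2p}(\phi_{n+1}+\zeta_{n+1}+\phi_{n-1}+\zeta_{n-1})=0,\quad n\in\mathbb Z,$$ with initial condition $\phi(0)=(\phi_n(0))_{n\in\mathbb Z}\in\ell^2$ and zero boundary conditions at infinity, $\lim_{|n|\to\infty}\phi_n(t)=0$, $t\ge0$, possesses a unique solution $\phi\in\overline{B(0,\rho)}\subset C([0,T];\ell^2)$, where $B(0,\rho)$ denotes the open ball centered at the origin with radius $$\rho=\rho(T)=2\Big[\|\phi(0)\|_{\ell^2}+\sqrt{2\kappa}\,\|\zeta'\|_{\ell^2}\sqrt T+|\mu|\Big(2^{2(p+2)}p\big(\|\zeta\|_{\ell^\infty}+q_0+\||\zeta|-q_0\|_{\ell^2}\big)^{2p+1}+2q_0^{2p}\|\zeta'\|_{\ell^2}\Big)T\Big],$$ and the lifespan $T>0$ satisfies $$2^{\frac72}|\mu|\Big[q_0^{2p}+2^{2p+\frac12}(2p+1)\big(\rho(T)+\|\zeta\|_{\ell^\infty}\big)^{2p}\Big]T\le1.$$ Furthermore, the solution depends continuously on the initial data.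
   Context: $\ell^r=\ell^r(\mathbb Z)$ are spaces of complex sequences; $(\Delta u)_n:=u_{n+1}+u_{n-1}-2u_n$; $\kappa>0$, $\mu\in\mathbb R$; $\zeta'_n:=\zeta_n-\zeta_{n-1}$; $X^1(\mathbb Z):=\{\zeta\in\ell^\infty:\zeta'\in\ell^2\}$; $|\zeta|-q_0$ denotes the sequence $(|\zeta_n|-q_0)_{n\in\mathbb Z}$. The background satisfies $\lim_{n\to\pm\infty}\zeta_n=\zeta_\pm\in\mathbb C$ with $|\zeta_\pm|=q_0>0$. $C([0,T];\ell^2)$ carries the norm $\sup_{t\in[0,T]}\|\cdot\|_{\ell^2}$. The equation arises from $i\frac{du_n}{dt}+\kappa(\Delta u)_n+\frac12\mu|u_n|^{2p}(u_{n+1}+u_{n-1})=0$ through $u_n(t)=e^{i\mu q_0^{2p}t}(\phi_n(t)+\zeta_n)$, so that $\phi_n(0)=u_n(0)-\zeta_n$. A solution is understood as a solution of the corresponding time-integrated (Duhamel) equation. *)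

(* Defs.v *)
From Stdlib Require Import Reals ZArith.
From Coquelicot Require Import Coquelicot.
Open Scope R_scope.

(* Real powers of a nonnegative base: [Rpower 0 a] is not [0] in the standard
   library, whereas |phi_n + zeta_n|^(2p) may well have base 0. *)
Definition rpow (x a : R) : R := if Rlt_dec 0 x then Rpower x a else 0.

Definition zseq : Type := Z -> C.

Definition seq_add (u v : zseq) : zseq := fun n => Cplus (u n) (v n).
Definition seq_sub (u v : zseq) : zseq := fun n => Cminus (u n) (v n).

Definition seq_lim_pinf (u : zseq) (l : C) : Prop :=
  filterlim (fun k : nat => u (Z.of_nat k)) eventually (locally l).
Definition seq_lim_minf (u : zseq) (l : C) : Prop :=
  filterlim (fun k : nat => u (- Z.of_nat k)%Z) eventually (locally l).

(* A sum over Z is split into the sums over n >= 0 and over n = -1-k, k >= 0. *)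
Definition ell2 (u : zseq) : Prop :=
  ex_series (fun k : nat => Cmod (u (Z.of_nat k)) ^ 2) /\
  ex_series (fun k : nat => Cmod (u (- 1 - Z.of_nat k)%Z) ^ 2).

(* Meaningful when [ell2 u]. *)
Definition ell2_norm (u : zseq) : R :=
  sqrt (Series (fun k : nat => Cmod (u (Z.of_nat k)) ^ 2) +
        Series (fun k : nat => Cmod (u (- 1 - Z.of_nat k)%Z) ^ 2)).

Definition ellinf (u : zseq) : Prop := exists M : R, forall n, Cmod (u n) <= M.

(* Meaningful when [ellinf u]. *)
Definition ellinf_norm (u : zseq) : R :=
  real (Lub_Rbar (fun x => exists n : Z, x = Cmod (u n))).

Definition bdiff (u : zseq) : zseq := fun n => Cminus (u n) (u (n - 1)%Z).

Definition lap (u : zseq) : zseq :=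
  fun n => (u (n + 1)%Z + u (n - 1)%Z - RtoC 2 * u n)%C.

Definition X1 (zeta : zseq) : Prop := ellinf zeta /\ ell2 (bdiff zeta).

Definition modulus_defect (q0 : R) (zeta : zseq) : zseq :=
  fun n => RtoC (Cmod (zeta n) - q0).

Definition cont_ell2 (T : R) (phi : R -> zseq) : Prop :=
  forall t, 0 <= t <= T ->
    ell2 (phi t) /\
    filterlim (fun s => ell2_norm (seq_sub (phi s) (phi t)))
      (within (fun s => 0 <= s <= T) (locally t)) (locally 0).

(* Meaningful when [cont_ell2 T phi]. *)
Definition sup_norm (T : R) (phi : R -> zseq) : R :=
  real (Lub_Rbar (fun x => exists t, 0 <= t <= T /\ x = ell2_norm (phi t))).

Definition closed_ball (T rho : R) (phi : R -> zseq) : Prop :=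
  cont_ell2 T phi /\ sup_norm T phi <= rho.

Definition CSeries (a : nat -> C) : C :=
  (Series (fun k => Re (a k)), Series (fun k => Im (a k))).

(* The group exp(i tau Delta), as the exponential series of the operator
   i tau Delta evaluated at the site n; for bounded u the series converges
   absolutely since |(Delta^k u)_n| <= 4^k sup |u|. *)
Definition exp_lap (tau : R) (u : zseq) : zseq :=
  fun n => CSeries (fun k =>
    (Ci * RtoC tau) ^ k / RtoC (INR (fact k)) * Nat.iter k lap u n)%C.

(* The equation reads i phi' + kappa Delta phi + forcing(phi) = 0. *)
Definition forcing (kappa mu q0 p : R) (zeta phi : zseq) : zseq :=
  let u := seq_add phi zeta in
  fun n =>
    (RtoC kappa * lap zeta n - RtoC (mu * rpow q0 (2 * p)) * u n
     + RtoC (mu / 2 * rpow (Cmod (u n)) (2 * p))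
       * (u (n + 1)%Z + u (n - 1)%Z))%C.

(* phi(t) = exp(i kappa t Delta) phi0
            + i int_0^t exp(i kappa (t-s) Delta) forcing(phi(s)) ds,
   read componentwise; [is_RInt] includes the existence of the integral. *)
Definition duhamel (kappa mu q0 p : R) (zeta phi0 : zseq) (T : R)
    (phi : R -> zseq) : Prop :=
  forall t, 0 <= t <= T -> forall n : Z,
    is_RInt (V := C_R_NormedModule)
      (fun s => Cmult Ci
         (exp_lap (kappa * (t - s)) (forcing kappa mu q0 p zeta (phi s)) n))
      0 t
      (Cminus (phi t n) (exp_lap (kappa * t) phi0 n)).

Definition solution (kappa mu q0 p : R) (zeta phi0 : zseq) (T : R)
    (phi : R -> zseq) : Prop :=
  duhamel kappa mu q0 p zeta phi0 T phi /\
  (forall n, phi 0 n = phi0 n) /\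
  (forall t, 0 <= t <= T ->
     seq_lim_pinf (phi t) (RtoC 0) /\ seq_lim_minf (phi t) (RtoC 0)).

Definition radius (kappa mu q0 p : R) (zeta phi0 : zseq) (T : R) : R :=
  2 * (ell2_norm phi0
       + sqrt (2 * kappa) * ell2_norm (bdiff zeta) * sqrt T
       + Rabs mu
         * (rpow 2 (2 * (p + 2)) * p
              * rpow (ellinf_norm zeta + q0 + ell2_norm (modulus_defect q0 zeta))
                     (2 * p + 1)
            + 2 * rpow q0 (2 * p) * ell2_norm (bdiff zeta))
         * T).

Definition lifespan_cond (kappa mu q0 p : R) (zeta phi0 : zseq) (T : R) : Prop :=
  rpow 2 (7 / 2) * Rabs mu
  * (rpow q0 (2 * p)
     + rpow 2 (2 * p + 1 / 2) * (2 * p + 1)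
       * rpow (radius kappa mu q0 p zeta phi0 T + ellinf_norm zeta) (2 * p))
  * T <= 1.

Definition ball_solution (kappa mu q0 p : R) (zeta phi0 : zseq) (T : R)
    (phi : R -> zseq) : Prop :=
  closed_ball T (radius kappa mu q0 p zeta phi0 T) phi /\
  solution kappa mu q0 p zeta phi0 T phi.

(* Main.v *)
Require Import Defs.
From Stdlib Require Import Reals ZArith.
From Coquelicot Require Import Coquelicot.
From Stdlib Require Import ssreflect Lra Lia Psatz.
From Stdlib Require Import ClassicalEpsilon FunctionalExtensionality.
From Stdlib Require Import PropExtensionality ProofIrrelevance.
Open Scope R_scope.

(** On the Hilbert space l^2 the bounded operator [A = i kappa Delta] is skew,
    since the real part of <u, i Delta u> telescopes.  Hence
    |u + h A u| = |u| + O(h^2), every solution of y' = A y has constant norm, and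
    exp(t A) is an isometric one-parameter group.

    The forcing splits as [kappa Delta zeta + N(phi)], where [N] is Lipschitz on
    the ball of radius rho with a constant L such that 8 L T <= 1 by the lifespan
    condition, and where N(0) is in l^2 because both |zeta| - q0 and zeta' are.
    The term [kappa Delta zeta] does not contribute linearly in T but through
    sqrt T: its convolution is [i kappa D g] with D the forward difference and
    g = int_0^t exp((t-s) A) zeta' ds, and |D g|^2 <= |g| |Delta g| with
    |g| <= t |zeta'| and kappa |Delta g| = |exp(t A) zeta' - zeta'| <= 2 |zeta'|.
    Thus the Duhamel map is a contraction of the ball, and the same estimate
    bounds the difference of two solutions by twice that of their data. *)

(** * Normed spaces and groups generated by skew operators *)

(** Everything is set in real normed modules, because derivatives and Riemann integrals are taken in
    a real variable: skewness becomes a norm inequality, and multiplication by i a bounded operator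
    commuting with the group. The statement is componentwise (scalar series, scalar integrals), the
    estimates live in l^2. Evaluation at a site is bounded and linear, so it carries l^2 series and
    integrals to components. Conversely, a componentwise solution in the ball is a continuous l^2
    curve, so its l^2 integral exists and must have the prescribed components. The crude bound
    |kappa Delta zeta| <= 2 kappa |zeta'| integrates to 2 kappa |zeta'| T, which exceeds sqrt(2
    kappa) |zeta'| sqrt T once 2 kappa T > 1; hence the interpolation. The factor 2 in the radius:
    the image of the zero curve takes at most rho / 2, and the Lipschitz part adds at most rho / 8.
    Solutions with different data lie in balls of different radii and are compared in the larger
    one. *)

Section Normed.
Context {U V : NormedModule R_AbsRing}.

Lemma continuous_norm_iff (f : R -> V) (t : R) :
  continuous f t <->
  forall eps, 0 < eps -> locally t (fun s => norm (minus (f s) (f t)) < eps).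
Proof.
split.
- intros Hf eps Heps.
  exact (proj1 (filterlim_locally_ball_norm f (f t)) Hf (mkposreal eps Heps)).
- intros H. apply filterlim_locally_ball_norm. intros [eps Heps]. exact (H eps Heps).
Qed.

Lemma norm_minus_sym (x y : V) : norm (minus x y) = norm (minus y x).
Proof. rewrite -(norm_opp (minus x y)) opp_minus. reflexivity. Qed.

Lemma norm_minus_le (x y : V) : norm (minus x y) <= norm x + norm y.
Proof. rewrite -(norm_opp y). apply (norm_triangle x (opp y)). Qed.

Lemma plus_minus_r (a b : V) : plus a (minus b a) = b.
Proof.
rewrite /minus. rewrite (plus_comm b) plus_assoc. rewrite plus_opp_r. apply plus_zero_l.
Qed.

Lemma norm_le_minus (x y : V) : norm x <= norm y + norm (minus x y).
Proof.
rewrite -{1}(plus_minus_r y x). apply norm_triangle.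
Qed.

Lemma norm_dist_triangle (x y z : V) :
  norm (minus x z) <= norm (minus x y) + norm (minus y z).
Proof. eapply Rle_trans; [right; apply (f_equal norm); exact (minus_trans y x z)|]. apply norm_triangle. Qed.

Lemma minus_plus_plus (a b c d : V) :
  minus (plus a b) (plus c d) = plus (minus a c) (minus b d).
Proof.
rewrite /minus. rewrite opp_plus -!plus_assoc. f_equal.
rewrite !plus_assoc. f_equal. apply plus_comm.
Qed.

Lemma minus_plus_l (a b : V) : minus (plus a b) a = b.
Proof.
rewrite /minus. rewrite (plus_comm a) -plus_assoc plus_opp_r. apply plus_zero_r.
Qed.

Lemma minus_eq_zero_inv (x y : V) : minus x y = zero -> x = y.
Proof. intros H. rewrite -(plus_minus_r y x) H. apply plus_zero_r. Qed.

Lemma is_linear_minus (l : U -> V) (x y : U) :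
  is_linear l -> l (minus x y) = minus (l x) (l y).
Proof.
intros Hl. rewrite /minus. rewrite (linear_plus _ Hl). f_equal.
rewrite -(scal_opp_one (K := R_Ring) y) (linear_scal _ Hl). exact (scal_opp_one (K := R_Ring) (l y)).
Qed.

Lemma is_linear_zero (l : U -> V) : is_linear l -> l zero = zero.
Proof.
intros Hl. rewrite -(scal_zero_l (K := R_Ring) zero) (linear_scal _ Hl). apply: (scal_zero_l (K := R_Ring)).
Qed.

(** A bounded linear map passes through Riemann sums and then through their limit. Used for
    operators on l^2 and, with a coordinate as [l], to go from l^2 integrals to scalar ones. *)
Lemma is_RInt_linear (l : U -> V) (f : R -> U) (a b : R) (I : U) :
  is_linear l -> is_RInt f a b I -> is_RInt (fun s => l (f s)) a b (l I).
Proof.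
intros Hl HI. unfold is_RInt in *.
apply filterlim_ext with
  (f := fun p => l (scal (sign (b - a)) (Riemann_sum f p))).
- intros p. rewrite (linear_scal _ Hl). f_equal.
  pattern p; apply SF_cons_ind; clear p.
  + intros x. apply (is_linear_zero l Hl).
  + intros h p IH. rewrite !Riemann_sum_cons (linear_plus _ Hl) IH.
    f_equal. apply (linear_scal _ Hl).
- exact (filterlim_comp _ _ _ _ l _ _ _ HI (linear_cont l I Hl)).
Qed.

Lemma is_series_linear (l : U -> V) (a : nat -> U) (s : U) :
  is_linear l -> is_series a s -> is_series (fun k => l (a k)) (l s).
Proof.
intros Hl Hs. unfold is_series in *.
apply filterlim_ext with (f := fun n => l (sum_n a n)).
- intros n. induction n as [|n IH].
  + rewrite !sum_O. reflexivity.
  + rewrite !sum_Sn (linear_plus _ Hl) IH. reflexivity.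
- exact (filterlim_comp _ _ _ _ l _ _ _ Hs (linear_cont l s Hl)).
Qed.

Lemma is_series_norm_le (a : nat -> V) (b : nat -> R) (s : V) (B : R) :
  is_series a s -> is_series b B -> (forall k, norm (a k) <= b k) -> norm s <= B.
Proof.
intros Ha Hb Hle.
apply (is_lim_seq_le (fun n => norm (sum_n a n)) (sum_n b) (norm s) B).
- intros n. induction n as [|n IH].
  + rewrite !sum_O. apply Hle.
  + rewrite !sum_Sn. eapply Rle_trans; [apply norm_triangle|].
    apply Rplus_le_compat; [exact IH|apply Hle].
- exact (filterlim_comp _ _ _ _ norm _ _ _ Ha (filterlim_norm s)).
- exact Hb.
Qed.

(** The structure provides only [<=]; applying it to [/ c] gives the converse. *)
Lemma norm_scal_eq (c : R) (x : V) : norm (scal c x) = Rabs c * norm x.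
Proof.
apply Rle_antisym; [exact (norm_scal c x)|].
destruct (Req_dec c 0) as [->|Hc].
{ rewrite Rabs_R0 Rmult_0_l. apply norm_ge_0. }
replace x with (scal (/ c) (scal c x)) at 1.
2:{ rewrite scal_assoc -[RHS](scal_one (K := R_Ring)). f_equal. apply Rinv_l, Hc. }
assert (H := norm_scal (/ c) (scal c x)).
apply Rmult_le_compat_l with (r := Rabs c) in H; [|apply Rabs_pos].
eapply Rle_trans; [exact H|]. unfold abs; simpl. rewrite Rabs_inv. right. field.
apply Rabs_no_R0, Hc.
Qed.

Lemma pow2_le_inv (a b : R) : 0 <= b -> a ^ 2 <= b ^ 2 -> a <= b.
Proof. intros Hb H. apply Rsqr_incr_0_var; [rewrite !Rsqr_pow2; exact H|exact Hb]. Qed.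

Lemma is_derive_of_little_o (f : R -> V) (t : R) (l : V) :
  (forall eps, 0 < eps -> locally t (fun s =>
     norm (minus (minus (f s) (f t)) (scal (s - t) l)) <= eps * Rabs (s - t))) ->
  is_derive f t l.
Proof.
intros H. split; [apply is_linear_scal_l|].
intros x Hx [eps Heps].
rewrite -(is_filter_lim_locally_unique _ _ Hx).
exact (H eps Heps).
Qed.

Lemma is_derive_little_o (f : R -> V) (t : R) (l : V) :
  is_derive f t l ->
  forall eps, 0 < eps -> locally t (fun s =>
     norm (minus (minus (f s) (f t)) (scal (s - t) l)) <= eps * Rabs (s - t)).
Proof.
intros [_ H] eps Heps.
exact (H t (fun P HP => HP) (mkposreal eps Heps)).
Qed.

End Normed.

(** * Exponential of a skew operator: isometry, group law, Duhamel integral *)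

Section Group.
Context {V : CompleteNormedModule R_AbsRing}.

(** In a Hilbert space Re <x, A x> = 0 gives |x + h A x|^2 = |x|^2 + h^2 |A x|^2. The inequality
    keeps what survives of this without an inner product. *)
Definition skew (A : V -> V) : Prop :=
  is_linear A /\
  exists M, 0 <= M /\ forall (x : V) (h : R),
    norm (plus x (scal h (A x))) ^ 2 <= (1 + M * h ^ 2) * norm x ^ 2.

Definition expA_term (A : V -> V) (t : R) (x : V) (k : nat) : V :=
  scal (t ^ k / INR (fact k)) (Nat.iter k A x).

Definition expA (A : V -> V) (t : R) (x : V) : V :=
  iota (is_series (expA_term A t x)).

Lemma is_series_exp (x : R) : is_series (fun k => x ^ k / INR (fact k)) (exp x).
Proof.
generalize (is_exp_Reals x). unfold is_pseries.
apply is_series_ext. intros n. rewrite pow_n_pow. reflexivity.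
Qed.

Lemma is_series_unicity {K : AbsRing} {W : NormedModule K} (a : nat -> W) (x y : W) :
  is_series a x -> is_series a y -> x = y.
Proof. apply (filterlim_locally_unique (F := eventually)). Qed.

Lemma iter_norm_le (A : V -> V) (M : R) (k : nat) (x : V) : 0 <= M ->
  (forall y, norm (A y) <= M * norm y) -> norm (Nat.iter k A x) <= M ^ k * norm x.
Proof.
intros HM HA. induction k as [|k IH]; simpl; [lra|].
eapply Rle_trans; [apply HA|]. rewrite Rmult_assoc.
apply Rmult_le_compat_l; assumption.
Qed.

Lemma expA_correct (A : V -> V) (t : R) (x : V) :
  is_linear A -> is_series (expA_term A t x) (expA A t x).
Proof.
intros HA. destruct (linear_norm _ HA) as [M [HM HMA]].
assert (Hex : ex_series (expA_term A t x)).
{ apply (ex_series_le _ (fun k => scal (norm x) ((Rabs t * M) ^ k / INR (fact k)))).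
  - intros k. unfold expA_term.
    eapply Rle_trans; [apply: norm_scal|]. unfold abs; simpl.
    rewrite Rabs_div; [|apply INR_fact_neq_0].
    rewrite -RPow_abs (Rabs_pos_eq (INR _)); [|apply pos_INR].
    unfold scal; simpl; unfold mult; simpl.
    rewrite Rpow_mult_distr.
    apply Rle_trans with (Rabs t ^ k / INR (fact k) * (M ^ k * norm x)).
    + apply Rmult_le_compat_l.
      * apply Rmult_le_pos; [apply pow_le, Rabs_pos|].
        apply Rlt_le, Rinv_0_lt_compat, INR_fact_lt_0.
      * apply iter_norm_le; [lra|exact HMA].
    + apply Req_le. unfold Rdiv. ring.
  - exists (scal (norm x) (exp (Rabs t * M))).
    apply: (is_series_scal (K := R_AbsRing) (V := R_NormedModule)).
    apply is_series_exp. }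
unfold expA. apply iota_correct. destruct Hex as [l Hl].
exists l. split; [exact Hl|]. intros y. apply is_series_unicity, Hl.
Qed.

Lemma expA_unique (A : V -> V) (t : R) (x y : V) :
  is_linear A -> is_series (expA_term A t x) y -> expA A t x = y.
Proof. intros HA. apply is_series_unicity, expA_correct, HA. Qed.

Lemma iter_linear (A : V -> V) (k : nat) : is_linear A -> is_linear (Nat.iter k A).
Proof.
intros HA. induction k as [|k IH]; simpl.
- apply is_linear_id.
- apply (is_linear_comp (Nat.iter k A) A); assumption.
Qed.

Lemma expA_plus (A : V -> V) (t : R) (x y : V) : is_linear A ->
  expA A t (plus x y) = plus (expA A t x) (expA A t y).
Proof.
intros HA. apply expA_unique; [exact HA|].
eapply is_series_ext; [|apply: is_series_plus; apply expA_correct; exact HA].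
intros k. unfold expA_term. rewrite (linear_plus _ (iter_linear A k HA)).
symmetry. apply: scal_distr_l.
Qed.

Lemma expA_scal (A : V -> V) (t c : R) (x : V) : is_linear A ->
  expA A t (scal c x) = scal c (expA A t x).
Proof.
intros HA. apply expA_unique; [exact HA|].
eapply is_series_ext; [|apply: is_series_scal; apply expA_correct; exact HA].
intros k. unfold expA_term. rewrite (linear_scal _ (iter_linear A k HA)).
rewrite !scal_assoc. f_equal. apply Rmult_comm.
Qed.

(** Applied below to multiplication by i and to the forward difference, both of which commute with
    the Laplacian. *)
Lemma expA_comm (A B : V -> V) (t : R) (x : V) :
  is_linear A -> is_linear B -> (forall y, A (B y) = B (A y)) ->
  expA A t (B x) = B (expA A t x).
Proof.
intros HA HB HAB. apply expA_unique; [exact HA|].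
eapply is_series_ext; [|apply (is_series_linear B), expA_correct; assumption].
intros k. unfold expA_term. rewrite (linear_scal _ HB). f_equal.
induction k as [|k IH]; simpl; [reflexivity|]. rewrite -HAB IH. reflexivity.
Qed.

Lemma expA_0 (A : V -> V) (x : V) : is_linear A -> expA A 0 x = x.
Proof.
intros HA. apply expA_unique; [exact HA|].
apply filterlim_ext with (f := fun _ : nat => x); [|apply filterlim_const].
intros n. induction n as [|n IH].
- rewrite sum_O. unfold expA_term; simpl. rewrite Rdiv_1_r. symmetry. apply (scal_one (K := R_Ring)).
- rewrite sum_Sn -IH. unfold expA_term. rewrite pow_i; [|lia].
  unfold Rdiv. rewrite Rmult_0_l. rewrite (scal_zero_l (K := R_Ring)).
  rewrite plus_zero_r. reflexivity.
Qed.

Definition taylor_pow (k : nat) (t h : R) : R :=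
  (t + h) ^ k - t ^ k - h * (INR k * t ^ pred k).

Lemma taylor_pow_S (k : nat) (t h : R) :
  taylor_pow (S k) t h = (t + h) * taylor_pow k t h + INR k * h ^ 2 * t ^ pred k.
Proof.
unfold taylor_pow. destruct k as [|k]; [simpl; ring|].
rewrite !S_INR. simpl pred. rewrite -!tech_pow_Rmult. ring.
Qed.

(** By the recurrence, [taylor_pow k] is a polynomial in t and h with nonnegative coefficients,
    hence majorized by its value at |t|, |h|. *)
Lemma taylor_pow_abs (k : nat) (t h : R) :
  Rabs (taylor_pow k t h) <= taylor_pow k (Rabs t) (Rabs h).
Proof.
induction k as [|k IH].
- unfold taylor_pow; simpl. replace (1 - 1 - h * (0 * 1)) with 0 by ring.
  rewrite Rabs_R0. lra.
- rewrite !taylor_pow_S.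
  eapply Rle_trans; [apply Rabs_triang|].
  apply Rplus_le_compat.
  + rewrite Rabs_mult. apply Rmult_le_compat; try apply Rabs_pos; [apply Rabs_triang|exact IH].
  + rewrite !Rabs_mult (Rabs_pos_eq (INR k)); [|apply pos_INR].
    rewrite Rabs_R1 -!RPow_abs. simpl. lra.
Qed.

Lemma is_series_taylor_pow (a b M : R) :
  is_series (fun k => taylor_pow k a b * M ^ k / INR (fact k))
    (exp (M * a) * (exp (M * b) - 1 - M * b)).
Proof.
assert (H1 := is_series_exp (M * (a + b))).
assert (H2 := is_series_exp (M * a)).
assert (H3 : is_series (fun k => b * (INR k * a ^ pred k) * M ^ k / INR (fact k))
               (M * b * exp (M * a))).
(* The term k = 0 vanishes because of the factor [INR k]; shifting the index leaves M b times the
   series of exp (M a). *)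
{ apply is_series_decr_1.
  eapply is_series_ext.
  2:{ replace (plus _ _) with (scal (M * b) (exp (M * a)) : R_NormedModule).
      2:{ unfold scal, plus, opp; simpl; unfold mult; simpl. field. }
      apply: is_series_scal; exact H2. }
  intros k. unfold scal; simpl; unfold mult; simpl.
  change (fact k + k * fact k)%nat with (fact (S k)).
  change (match k with O => 1 | S _ => INR k + 1 end) with (INR (S k)).
  rewrite fact_simpl mult_INR Rpow_mult_distr. field.
  split; [apply INR_fact_neq_0|apply not_0_INR; lia]. }
assert (H4 := is_series_minus _ _ _ _ (is_series_minus _ _ _ _ H1 H2) H3).
replace (exp (M * a) * _) with
  (plus (plus (exp (M * (a + b))) (opp (exp (M * a)))) (opp (M * b * exp (M * a))) : R).
- eapply is_series_ext; [|exact H4].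
  intros k. unfold plus, opp, taylor_pow; simpl. rewrite !Rpow_mult_distr. field.
  apply INR_fact_neq_0.
- unfold plus, opp; simpl. rewrite Rmult_plus_distr_l exp_plus. ring.
Qed.

(** The series is the termwise derivative in t of the exponential series; dropping its vanishing
    first term pulls out one factor A. *)
Lemma expA_generator_series (A : V -> V) (t : R) (x : V) : is_linear A ->
  is_series (fun k => scal (INR k * t ^ pred k / INR (fact k)) (Nat.iter k A x))
    (A (expA A t x)).
Proof.
intros HA. apply is_series_decr_1.
replace (plus (A (expA A t x)) _) with (A (expA A t x)).
- eapply is_series_ext; [|apply (is_series_linear A), expA_correct; assumption].
  intros k. unfold expA_term. rewrite (linear_scal _ HA). simpl Nat.iter. f_equal.
  simpl pred. rewrite fact_simpl mult_INR. field.
  split; [apply INR_fact_neq_0|apply not_0_INR; lia].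
- simpl INR. unfold Rdiv. rewrite !Rmult_0_l (scal_zero_l (K := R_Ring)).
  rewrite opp_zero plus_zero_r. reflexivity.
Qed.

(** Subtracting the three series termwise leaves [taylor_pow k t h / k!] times A^k x, and the scalar
    majorant sums to the Taylor remainder of exp. *)
Lemma expA_taylor (A : V -> V) (M t h : R) (x : V) :
  is_linear A -> 0 <= M -> (forall y, norm (A y) <= M * norm y) ->
  norm (minus (minus (expA A (t + h) x) (expA A t x)) (scal h (A (expA A t x))))
  <= exp (M * Rabs t) * (exp (M * Rabs h) - 1 - M * Rabs h) * norm x.
Proof.
intros HA HM HMA.
assert (H := is_series_minus _ _ _ _
  (is_series_minus _ _ _ _ (expA_correct A (t + h) x HA) (expA_correct A t x HA))
  (is_series_scal h _ _ (expA_generator_series A t x HA))).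
eapply is_series_norm_le; [exact H| |].
- apply is_series_ext with
    (a := fun k => scal (norm x) (taylor_pow k (Rabs t) (Rabs h) * M ^ k / INR (fact k))).
  { intros k; reflexivity. }
  rewrite Rmult_comm. apply: (is_series_scal (norm x)); apply is_series_taylor_pow.
- intros k. unfold expA_term.
  replace (plus _ _) with (scal (taylor_pow k t h / INR (fact k)) (Nat.iter k A x)).
  2:{ rewrite scal_assoc -!scal_opp_l -!scal_distr_r.
      f_equal. unfold plus, opp, scal, taylor_pow; simpl; unfold mult; simpl. field. apply INR_fact_neq_0. }
  eapply Rle_trans; [apply: norm_scal|]. unfold abs, scal; simpl; unfold mult; simpl.
  rewrite Rabs_div; [|apply INR_fact_neq_0].
  rewrite (Rabs_pos_eq (INR _)); [|apply pos_INR].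
  apply Rle_trans with (taylor_pow k (Rabs t) (Rabs h) / INR (fact k) * (M ^ k * norm x)).
  + apply Rmult_le_compat.
    * apply Rmult_le_pos; [apply Rabs_pos|].
      apply Rlt_le, Rinv_0_lt_compat, INR_fact_lt_0.
    * apply norm_ge_0.
    * apply Rmult_le_compat_r; [|apply taylor_pow_abs].
      apply Rlt_le, Rinv_0_lt_compat, INR_fact_lt_0.
    * apply iter_norm_le; assumption.
  + apply Req_le. unfold Rdiv. ring.
Qed.

Lemma exp_second_order_small (M eps : R) : 0 < M -> 0 < eps ->
  exists d, 0 < d /\ forall y, 0 <= y < d -> exp (M * y) - 1 - M * y <= eps * y.
Proof.
intros HM Heps.
destruct (derivable_pt_lim_exp 0 (eps / M)) as [[d Hd] H].
{ apply Rdiv_lt_0_compat; assumption. }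
simpl in H. exists (d / M). split; [apply Rdiv_lt_0_compat; assumption|].
intros y [Hy0 Hyd]. destruct (Req_dec y 0) as [->|Hy].
{ rewrite Rmult_0_r exp_0. lra. }
assert (HMy : 0 < M * y) by (apply Rmult_lt_0_compat; lra).
assert (HMd : M * y < d).
{ apply Rmult_lt_compat_l with (r := M) in Hyd; [|exact HM].
  replace (M * (d / M)) with d in Hyd by (field; lra). exact Hyd. }
specialize (H (M * y) ltac:(lra) ltac:(rewrite Rabs_pos_eq; lra)).
rewrite Rplus_0_l exp_0 in H. apply Rabs_lt_between in H as [_ H].
apply Rmult_lt_compat_r with (r := M * y) in H; [|exact HMy].
replace (((exp (M * y) - 1) / (M * y) - 1) * (M * y)) with (exp (M * y) - 1 - M * y) in H
  by (field; lra).
replace (eps / M * (M * y)) with (eps * y) in H by (field; lra). lra.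
Qed.

Lemma is_derive_expA (A : V -> V) (t : R) (x : V) : is_linear A ->
  is_derive (fun s => expA A s x) t (A (expA A t x)).
Proof.
intros HA. destruct (linear_norm _ HA) as [M [HM HMA]].
apply is_derive_of_little_o. intros eps Heps.
(* The [+ 1] keeps K positive when x is zero, so that eps / K is defined. *)
set (K := exp (M * Rabs t) * (norm x + 1)).
assert (HK : 0 < K).
{ apply Rmult_lt_0_compat; [apply exp_pos|]. generalize (norm_ge_0 x). lra. }
destruct (exp_second_order_small M (eps / K)) as [d [Hd Hexp]].
{ exact HM. } { apply Rdiv_lt_0_compat; assumption. }
exists (mkposreal d Hd). intros s Hs.
assert (Hs' : Rabs (s - t) < d) by exact Hs.
replace s with (t + (s - t)) at 1 by ring.
eapply Rle_trans; [apply (expA_taylor A M t (s - t) x HA); [lra|exact HMA]|].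
assert (He := Hexp (Rabs (s - t)) (conj (Rabs_pos _) Hs')).
assert (He0 : 0 <= exp (M * Rabs (s - t)) - 1 - M * Rabs (s - t)).
{ generalize (exp_ineq1_le (M * Rabs (s - t))). lra. }
apply Rle_trans with (K * (exp (M * Rabs (s - t)) - 1 - M * Rabs (s - t))).
- unfold K. replace (exp (M * Rabs t) * (norm x + 1) * _) with
   (exp (M * Rabs t) * (exp (M * Rabs (s - t)) - 1 - M * Rabs (s - t)) * (norm x + 1)) by ring.
  apply Rmult_le_compat_l; [|lra]. apply Rmult_le_pos; [apply Rlt_le, exp_pos|exact He0].
- apply Rmult_le_compat_l with (r := K) in He; [|lra].
  replace (K * (eps / K * Rabs (s - t))) with (eps * Rabs (s - t)) in He by (field; lra).
  exact He.
Qed.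

(** A norm need not be differentiable, but along the flow it changes by O(h^2) plus the o(h) error
    of the linear approximation, so its derivative exists and is 0. *)
Lemma flow_norm_const (A : V -> V) (y : R -> V) : skew A ->
  (forall t, is_derive y t (A (y t))) -> forall t, norm (y t) = norm (y 0).
Proof.
intros [HA [M [HM Hskew]]] Hy.
(* With a = M h^2 >= 0 this is sqrt (1 + a) <= 1 + a. *)
assert (Hup : forall x h, norm (plus x (scal h (A x))) <= norm x + M * h ^ 2 * norm x).
{ intros x h.
  assert (H2 := pow2_ge_0 h). assert (Hn := norm_ge_0 x).
  assert (H3 : 0 <= M * h ^ 2) by (apply Rmult_le_pos; assumption).
  assert (H4 : 0 <= M * h ^ 2 * norm x) by (apply Rmult_le_pos; assumption).
  assert (H5 : 0 <= M * h ^ 2 * norm x ^ 2) by (apply Rmult_le_pos; [exact H3|apply pow2_ge_0]).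
  apply pow2_le_inv; [lra|].
  eapply Rle_trans; [exact (Hskew x h)|].
  assert (H6 := pow2_ge_0 (M * h ^ 2 * norm x)). lra. }
(* Lower bound from the upper bound at -h, since 2 x = (x + h A x) + (x - h A x). *)
assert (Hlow : forall x h, norm x - M * h ^ 2 * norm x <= norm (plus x (scal h (A x)))).
{ intros x h.
  assert (H1 := Hup x (- h)).
  assert (H2 : norm (scal 2 x) <= norm (plus x (scal h (A x))) + norm (plus x (scal (- h) (A x)))).
  { replace (scal 2 x) with (plus (plus x (scal h (A x))) (plus x (scal (- h) (A x)))).
    - apply norm_triangle.
    - rewrite scal_opp_l.
      rewrite (plus_comm x (opp _)) plus_assoc -(plus_assoc x) plus_opp_r plus_zero_r.
      replace 2 with (1 + 1) by ring. rewrite scal_distr_r !(scal_one (K := R_Ring)). reflexivity. }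
  rewrite norm_scal_eq (Rabs_pos_eq 2) in H2; [|lra].
  replace ((- h) ^ 2) with (h ^ 2) in H1 by ring.
  assert (H3 := Rle_trans _ _ _ H2 (Rplus_le_compat_l _ _ _ H1)). lra. }
assert (Hder : forall t, is_derive (fun s => norm (y s)) t 0).
{ intros t. apply is_derive_of_little_o. intros eps Heps.
  set (K := M * norm (y t) + 1).
  assert (HMn : 0 <= M * norm (y t)) by (apply Rmult_le_pos; [exact HM|apply norm_ge_0]).
  assert (Heps2 : 0 < eps / 2) by lra.
  assert (HK : 0 < eps / 2 / K) by (apply Rdiv_lt_0_compat; unfold K; lra).
  assert (Hloc : locally t (fun s => Rabs (s - t) < eps / 2 / K)).
  { exists (mkposreal _ HK). intros s Hs. exact Hs. }
  generalize (filter_and _ _ (is_derive_little_o y t _ (Hy t) (eps / 2) Heps2) Hloc).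
  apply filter_imp. intros s [Hs1 Hs2].
  pose (z := plus (y t) (scal (s - t) (A (y t)))).
  assert (H0 : norm (minus (y s) z) <= eps / 2 * Rabs (s - t)).
  { eapply Rle_trans; [right|exact Hs1]. f_equal.
    rewrite /z /minus opp_plus plus_assoc. reflexivity. }
  assert (H1 : norm z <= _) by exact (Hup (y t) (s - t)).
  assert (H2 : _ <= norm z) by exact (Hlow (y t) (s - t)).
  assert (H3 := norm_triangle_inv (y s) z).
  apply Rabs_le_between in H3.
  assert (Hsq : M * (s - t) ^ 2 * norm (y t) <= eps / 2 * Rabs (s - t)).
  { rewrite -(pow2_abs (s - t)).
    replace (M * Rabs (s - t) ^ 2 * norm (y t)) with
      (M * norm (y t) * Rabs (s - t) * Rabs (s - t)) by ring.
    apply Rmult_le_compat_r; [apply Rabs_pos|].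
    apply Rle_trans with (K * (eps / 2 / K)); [|right; field; unfold K; lra].
    apply Rmult_le_compat; try lra; [apply Rabs_pos|unfold K; lra]. }
  unfold norm at 1; simpl. unfold abs, minus, plus, opp, scal; simpl. unfold mult; simpl.
  rewrite Rmult_0_r Ropp_0 Rplus_0_r.
  apply Rabs_le.
  (* [lra] does not identify norms that differ in their structure projections. *)
  assert (Hreal : forall a b c m q r : R, m <= eps / 2 * r -> c <= b + q -> b - q <= c ->
    - m <= a - c <= m -> q <= eps / 2 * r -> - (eps * r) <= a + - b <= eps * r)
    by (intros; lra).
  exact (Hreal _ _ _ _ _ _ H0 H1 H2 H3 Hsq). }
intros t. destruct (Rtotal_order t 0) as [Ht|[->|Ht]]; [|reflexivity|].
- apply (eq_is_derive (fun s => norm (y s)) t 0); [intros; apply Hder|exact Ht].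
- symmetry. apply (eq_is_derive (fun s => norm (y s)) 0 t); [intros; apply Hder|exact Ht].
Qed.

Lemma expA_norm (A : V -> V) (t : R) (x : V) : skew A -> norm (expA A t x) = norm x.
Proof.
intros HA. rewrite (flow_norm_const A (fun s => expA A s x) HA).
- rewrite expA_0; [|apply HA]. reflexivity.
- intros s. apply is_derive_expA, HA.
Qed.

Lemma expA_linear (A : V -> V) (t : R) : skew A -> is_linear (expA A t).
Proof.
intros HA. split.
- intros x y. apply expA_plus, HA.
- intros c x. apply expA_scal, HA.
- exists 1. split; [lra|]. intros x. rewrite expA_norm; [lra|exact HA].
Qed.

(** As functions of s both sides solve y' = A y and agree at s = 0; their difference is a solution
    of constant norm, hence zero. *)
Lemma expA_group (A : V -> V) (s t : R) (x : V) : skew A ->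
  expA A s (expA A t x) = expA A (s + t) x.
Proof.
intros HA. apply minus_eq_zero_inv, norm_eq_zero.
rewrite (flow_norm_const A (fun r => minus (expA A r (expA A t x)) (expA A (r + t) x)) HA).
- rewrite expA_0; [|apply HA]. rewrite Rplus_0_l minus_eq_zero. exact (norm_zero (V := V)).
- intros r. rewrite (is_linear_minus A); [|apply HA].
  apply: is_derive_minus; [apply is_derive_expA, HA|].
  rewrite -((scal_one (K := R_Ring)) (A (expA A (r + t) x))).
  apply: (is_derive_comp (fun q => expA A q x) (fun q => q + t)).
  + apply is_derive_expA, HA.
  + auto_derive; [exact I|reflexivity].
Qed.

(** First the time varies with the vector fixed, then the vector; the second change costs |f s - f
    t| whatever the time, by isometry. *)
Lemma expA_continuous (A : V -> V) (c : R -> R) (f : R -> V) (t : R) : skew A ->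
  continuous c t -> continuous f t -> continuous (fun s => expA A (c s) (f s)) t.
Proof.
intros HA Hc Hf. refine (proj2 (continuous_norm_iff _ _) _). intros eps Heps.
assert (Heps2 : 0 < eps / 2) by lra.
assert (Hu : continuous (fun s => expA A (c s) (f t)) t).
{ apply (continuous_comp c (fun r => expA A r (f t))); [exact Hc|].
  apply: ex_derive_continuous. eexists. apply is_derive_expA, HA. }
assert (H1 := proj1 (continuous_norm_iff (V := V) _ t) Hu (eps / 2) Heps2).
assert (H2 := proj1 (continuous_norm_iff f t) Hf (eps / 2) Heps2).
generalize (filter_and _ _ H1 H2). clear H1 H2.
apply filter_imp. intros s [H1 H2].
eapply Rle_lt_trans; [apply (norm_dist_triangle _ (expA A (c s) (f t)))|].
rewrite -(is_linear_minus _ _ _ (expA_linear A (c s) HA)) expA_norm; [lra|exact HA].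
Qed.

(** The convolution of exp((t-s)A) with f, with exp(tA) taken out by the group law: the remaining
    integrand is free of t, so continuity in t follows from the fundamental theorem of calculus. *)
Definition duhamelA (A : V -> V) (f : R -> V) (t : R) : V :=
  expA A t (RInt (fun s => expA A (- s) (f s)) 0 t).

Lemma duhamelA_integrand_continuous (A : V -> V) (f : R -> V) : skew A ->
  (forall s, continuous f s) -> forall s, continuous (fun s => expA A (- s) (f s)) s.
Proof.
intros HA Hf s. apply (expA_continuous A Ropp); [exact HA| |apply Hf].
apply (continuous_opp (fun x : R => x)), continuous_id.
Qed.

Lemma is_RInt_duhamelA (A : V -> V) (f : R -> V) (t : R) : skew A ->
  (forall s, continuous f s) ->
  is_RInt (fun s => expA A (t - s) (f s)) 0 t (duhamelA A f t).
Proof.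
intros HA Hf.
apply is_RInt_ext with (f := fun s => expA A t (expA A (- s) (f s))).
- intros s _. apply expA_group, HA.
- apply (is_RInt_linear (expA A t)); [apply expA_linear, HA|].
  apply (RInt_correct (V := V)), (ex_RInt_continuous (V := V)).
  intros s _. apply duhamelA_integrand_continuous; assumption.
Qed.

Lemma duhamelA_continuous (A : V -> V) (f : R -> V) (t : R) : skew A ->
  (forall s, continuous f s) -> continuous (duhamelA A f) t.
Proof.
intros HA Hf. apply expA_continuous; [exact HA|apply continuous_id|].
apply: ex_derive_continuous. eexists.
apply: (is_derive_RInt (fun s => expA A (- s) (f s)) _ 0).
- apply filter_forall. intros r. apply (RInt_correct (V := V)), (ex_RInt_continuous (V := V)).
  intros s _. apply duhamelA_integrand_continuous; assumption.
- apply duhamelA_integrand_continuous; assumption.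
Qed.

Lemma is_RInt_duhamel_norm (A : V -> V) (f : R -> V) (t K : R) (I : V) : skew A ->
  0 <= t -> (forall s, 0 <= s <= t -> norm (f s) <= K) ->
  is_RInt (fun s => expA A (t - s) (f s)) 0 t I -> norm I <= t * K.
Proof.
intros HA Ht HK HI. rewrite -{1}(Rminus_0_r t).
apply (norm_RInt_le_const _ 0 t I K Ht) in HI; [exact HI|].
intros s Hs. rewrite expA_norm; [|exact HA]. apply HK, Hs.
Qed.

End Group.

(** * Mild solutions by Picard iteration *)

Lemma le_of_geometric (a C : R) : (forall k : nat, a <= C * (1 / 2) ^ k) -> a <= 0.
Proof.
intros H.
apply (is_lim_seq_le (fun _ => a) (fun k => C * (1 / 2) ^ k) a 0 H).
- apply is_lim_seq_const.
- replace (Finite 0) with (Rbar_mult C 0) by (simpl; f_equal; ring).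
  apply is_lim_seq_scal_l, is_lim_seq_geom. rewrite Rabs_pos_eq; lra.
Qed.

(** Composition with [clamp] extends a curve on [0, T] by constants, so that continuity can be asked
    at every real time. *)
Definition clamp (T s : R) : R := Rmax 0 (Rmin s T).

Lemma clamp_range (T s : R) : 0 <= T -> 0 <= clamp T s <= T.
Proof. intros HT. unfold clamp, Rmax, Rmin. repeat destruct Rle_dec; lra. Qed.

Lemma clamp_id (T s : R) : 0 <= s <= T -> clamp T s = s.
Proof. intros Hs. unfold clamp, Rmax, Rmin. repeat destruct Rle_dec; lra. Qed.

Lemma clamp_continuous (T t : R) : continuous (clamp T) t.
Proof.
intros P [eps HP]. exists eps. intros s Hs. apply HP.
assert (Hs' : Rabs (s - t) < eps) by exact Hs.
change (Rabs (clamp T s - clamp T t) < eps).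
eapply Rle_lt_trans; [|exact Hs'].
unfold clamp, Rmax, Rmin, Rabs.
repeat destruct Rle_dec; repeat destruct Rcase_abs; lra.
Qed.

Section Mild.
Context {V : CompleteNormedModule R_AbsRing}.

(** The increments form an absolutely convergent series. The explicit rate matters: for curves it is
    the same at all times, so pointwise limits are uniform. *)
Lemma geometric_cauchy_limit (a : nat -> V) (C : R) :
  (forall k, norm (minus (a (S k)) (a k)) <= C * (1 / 2) ^ k) ->
  exists l, forall k, norm (minus l (a k)) <= 2 * C * (1 / 2) ^ k.
Proof.
intros Ha.
assert (Hsum : ex_series (fun k => minus (a (S k)) (a k))).
{ apply (ex_series_le _ (fun k => C * (1 / 2) ^ k) Ha).
  apply (ex_series_scal_l C (fun k => (1 / 2) ^ k)).
  apply ex_series_geom. rewrite Rabs_pos_eq; lra. }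
destruct Hsum as [l Hl]. exists (plus l (a O)). intros k.
assert (Htele : forall n, minus (sum_n (fun k => minus (a (S k)) (a k)) n) l
                 = minus (a (S n)) (plus l (a O))).
{ intros n.
  assert (E : sum_n (fun k => minus (a (S k)) (a k)) n = minus (a (S n)) (a O)).
  { induction n as [|n IH]; [apply sum_O|].
    rewrite sum_Sn IH plus_comm. symmetry. exact (minus_trans (a (S n)) _ _). }
  rewrite E /minus opp_plus -plus_assoc. f_equal. apply plus_comm. }
assert (Hfin : forall m, norm (minus (a (k + m)%nat) (a k)) <=
                 2 * C * (1 / 2) ^ k * (1 - (1 / 2) ^ m)).
{ induction m as [|m IH].
  - rewrite Nat.add_0_r minus_eq_zero. simpl.
    rewrite (norm_zero (V := V)). lra.
  - rewrite Nat.add_succ_r.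
    eapply Rle_trans; [apply (norm_dist_triangle _ (a (k + m)%nat))|].
    eapply Rle_trans; [apply Rplus_le_compat; [exact (Ha (k + m)%nat)|exact IH]|].
    rewrite pow_add. simpl. lra. }
assert (HC : 0 <= C).
{ specialize (Ha O). simpl in Ha. generalize (norm_ge_0 (minus (a 1%nat) (a 0%nat))). lra. }
assert (Hpow : forall n, 0 < (1 / 2) ^ n) by (intros n; apply pow_lt; lra).
apply le_epsilon. intros eps Heps.
destruct (proj1 (filterlim_locally_ball_norm _ l) Hl (mkposreal eps Heps)) as [N HN].
assert (HN' := HN (k + N)%nat ltac:(lia)). unfold ball_norm in HN'. simpl in HN'.
rewrite Htele in HN'.
eapply Rle_trans; [apply (norm_dist_triangle _ (a (S (k + N))))|].
rewrite norm_minus_sym -Nat.add_succ_r.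
rewrite -Nat.add_succ_r in HN'.
assert (0 <= 2 * C * (1 / 2) ^ k * (1 / 2) ^ (S N)).
{ repeat apply Rmult_le_pos; try lra; apply Rlt_le, Hpow. }
eapply Rle_trans; [apply Rplus_le_compat; [apply Rlt_le; exact HN'|exact (Hfin (S N))]|].
lra.
Qed.

Lemma uniform_limit_continuous (a : nat -> R -> V) (f : R -> V) (C t : R) :
  (forall k s, norm (minus (f s) (a k s)) <= C * (1 / 2) ^ k) ->
  (forall k, continuous (a k) t) -> continuous f t.
Proof.
intros Hu Ha. refine (proj2 (continuous_norm_iff _ _) _). intros eps Heps.
assert (Hk : exists k, C * (1 / 2) ^ k < eps / 3).
{ apply NNPP. intros Hn.
  assert (H : forall k, eps / 3 <= C * (1 / 2) ^ k).
  { intros k. apply Rnot_lt_le. intros Hk. apply Hn. exists k. exact Hk. }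
  apply le_of_geometric in H. lra. }
destruct Hk as [k Hk].
generalize (proj1 (continuous_norm_iff (a k) t) (Ha k) (eps / 3) ltac:(lra)).
apply filter_imp. intros s Hs.
eapply Rle_lt_trans; [apply (norm_dist_triangle _ (a k s))|].
assert (H1 := norm_dist_triangle (a k s) (a k t) (f t)).
assert (H2 := Hu k s). assert (H3 := Hu k t).
rewrite norm_minus_sym in H3.
eapply Rle_lt_trans.
{ apply Rplus_le_compat; [exact H2|]. eapply Rle_trans; [exact H1|].
  apply Rplus_le_compat; [apply Rlt_le; exact Hs|exact H3]. }
lra.
Qed.

Lemma lipschitz_ball_continuous (G : V -> V) (L rho : R) (f : R -> V) (t : R) :
  (forall x y, norm x <= rho -> norm y <= rho ->
     norm (minus (G x) (G y)) <= L * norm (minus x y)) ->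
  (forall s, norm (f s) <= rho) -> continuous f t -> continuous (fun s => G (f s)) t.
Proof.
intros HG Hf Hc. refine (proj2 (continuous_norm_iff _ _) _). intros eps Heps.
(* A positive Lipschitz constant to divide by, whatever the sign of L. *)
assert (HL : 0 < Rabs L + 1) by (generalize (Rabs_pos L); lra).
generalize (proj1 (continuous_norm_iff f t) Hc (eps / (Rabs L + 1))
  ltac:(apply Rdiv_lt_0_compat; assumption)).
apply filter_imp. intros s Hs.
eapply Rle_lt_trans; [apply HG; apply Hf|].
apply Rle_lt_trans with ((Rabs L + 1) * norm (minus (f s) (f t))).
- apply Rmult_le_compat_r; [apply norm_ge_0|]. generalize (Rle_abs L). lra.
- apply Rmult_lt_compat_l with (r := Rabs L + 1) in Hs; [|exact HL].
  replace ((Rabs L + 1) * (eps / (Rabs L + 1))) with eps in Hs by (field; lra).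
  exact Hs.
Qed.

Lemma duhamelA_diff_norm (A : V -> V) (f g : R -> V) (t K : R) : skew A ->
  (forall s, continuous f s) -> (forall s, continuous g s) -> 0 <= t ->
  (forall s, 0 <= s <= t -> norm (minus (f s) (g s)) <= K) ->
  norm (minus (duhamelA A f t) (duhamelA A g t)) <= t * K.
Proof.
intros HA Hf Hg Ht HK.
apply (is_RInt_duhamel_norm A (fun s => minus (f s) (g s)) t K _ HA Ht HK).
assert (H := is_RInt_minus _ _ _ _ _ _ (is_RInt_duhamelA A f t HA Hf)
                                        (is_RInt_duhamelA A g t HA Hg)).
eapply is_RInt_ext; [|exact H]. intros s _. symmetry.
apply (is_linear_minus (expA A (t - s))), expA_linear, HA.
Qed.

Definition mild (A G : V -> V) (x0 : V) (T : R) (phi : R -> V) : Prop :=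
  forall t, 0 <= t <= T ->
    is_RInt (fun s => expA A (t - s) (G (phi s))) 0 t (minus (phi t) (expA A t x0)).

(** Picard iteration from the zero curve. The last hypothesis bounds the image of zero and leaves
    room L T rho for the distance to the image of any other curve in the ball, so the ball is
    preserved; L T <= 1/2 gives the rate. *)
Lemma mild_exists (A G : V -> V) (L rho T : R) (x0 : V) : skew A ->
  0 < T -> 0 <= rho -> 0 <= L -> L * T <= 1 / 2 ->
  (forall x y, norm x <= rho -> norm y <= rho ->
     norm (minus (G x) (G y)) <= L * norm (minus x y)) ->
  (forall t, 0 <= t <= T ->
     norm (plus (expA A t x0) (duhamelA A (fun _ => G zero) t)) + L * T * rho <= rho) ->
  exists phi : R -> V,
    (forall t, continuous phi t) /\ (forall t, norm (phi t) <= rho) /\ mild A G x0 T phi.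
Proof.
intros HA HT Hrho HL HLT HG H0.
pose (Lam := fun (phi : R -> V) (t : R) =>
  plus (expA A (clamp T t) x0) (duhamelA A (fun s => G (phi s)) (clamp T t))).
assert (HLam_cont : forall phi, (forall s, continuous (fun s => G (phi s)) s) ->
  forall t, continuous (Lam phi) t).
{ intros phi Hphi t. apply: continuous_plus.
  - apply expA_continuous; [exact HA|apply clamp_continuous|apply continuous_const].
  - apply (continuous_comp (clamp T)); [apply clamp_continuous|].
    apply duhamelA_continuous; assumption. }
assert (HLam_diff : forall phi psi K, 0 <= K ->
  (forall s, continuous (fun s => G (phi s)) s) ->
  (forall s, continuous (fun s => G (psi s)) s) ->
  (forall s, norm (phi s) <= rho) -> (forall s, norm (psi s) <= rho) ->
  (forall s, norm (minus (phi s) (psi s)) <= K) ->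
  forall t, norm (minus (Lam phi t) (Lam psi t)) <= L * T * K).
{ intros phi psi K HK Hc1 Hc2 Hb1 Hb2 Hd t.
  destruct (clamp_range T t (Rlt_le _ _ HT)) as [Ht1 Ht2].
  unfold Lam. rewrite minus_plus_plus minus_eq_zero plus_zero_l.
  apply Rle_trans with (clamp T t * (L * K)).
  - apply duhamelA_diff_norm; try assumption.
    intros s _. eapply Rle_trans; [apply HG; [apply Hb1|apply Hb2]|].
    apply Rmult_le_compat_l; [exact HL|apply Hd].
  - replace (L * T * K) with (T * (L * K)) by ring.
    apply Rmult_le_compat_r; [|exact Ht2]. apply Rmult_le_pos; assumption. }
pose (it := fix it (k : nat) : R -> V :=
  match k with O => fun _ => zero | S k => Lam (it k) end).
assert (Hzero : norm (zero : V) <= rho) by (rewrite norm_zero; exact Hrho).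
assert (Hit : forall k, (forall t, continuous (it k) t) /\ (forall t, norm (it k t) <= rho)).
{ induction k as [|k [IHc IHb]].
  - split; intros t; [apply continuous_const|exact Hzero].
  - assert (HGk : forall s, continuous (fun s => G (it k s)) s).
    { intros s. apply (lipschitz_ball_continuous G L rho); [exact HG|exact IHb|apply IHc]. }
    split; [apply HLam_cont, HGk|]. intros t. change (it (S k) t) with (Lam (it k) t).
    eapply Rle_trans; [apply (norm_le_minus _ (Lam (fun _ => zero) t))|].
    eapply Rle_trans; [|apply (H0 (clamp T t)), clamp_range; lra].
    apply Rplus_le_compat_l. apply HLam_diff; try assumption.
    + intros s; apply continuous_const.
    + intros _; exact Hzero.
    + intros s. rewrite minus_zero_r. apply IHb. }
assert (HGit : forall k s, continuous (fun s => G (it k s)) s).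
{ intros k s. apply (lipschitz_ball_continuous G L rho); [exact HG|apply Hit|apply Hit]. }
assert (Hpow : forall k, 0 < (1 / 2) ^ k) by (intros k; apply pow_lt; lra).
assert (Hstep : forall k t, norm (minus (it (S k) t) (it k t)) <= rho * (1 / 2) ^ k).
{ induction k as [|k IH]; intros t.
  - change (it O t) with (zero : V). rewrite minus_zero_r Rmult_1_r. apply Hit.
  - change (norm (minus (Lam (it (S k)) t) (Lam (it k) t)) <= rho * (1 / 2) ^ S k).
    assert (HK : 0 <= rho * (1 / 2) ^ k)
      by (apply Rmult_le_pos; [exact Hrho|apply Rlt_le, Hpow]).
    eapply Rle_trans; [apply (HLam_diff _ _ _ HK)|]; try apply Hit; try apply HGit; try apply IH.
    simpl. replace (rho * (1 / 2 * (1 / 2) ^ k)) with (1 / 2 * (rho * (1 / 2) ^ k)) by ring.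
    apply Rmult_le_compat_r; assumption. }
(* Limits are chosen separately at each time, with a rate that does not depend on the time. *)
pose (lim_ex := fun t => constructive_indefinite_description _
  (geometric_cauchy_limit (fun k => it k t) rho (fun k => Hstep k t))).
pose (phi := fun t => proj1_sig (lim_ex t)).
assert (Hphi : forall k t, norm (minus (phi t) (it k t)) <= 2 * rho * (1 / 2) ^ k).
{ intros k t. exact (proj2_sig (lim_ex t) k). }
assert (Hphi_c : forall t, continuous phi t).
{ intros t. apply (uniform_limit_continuous it phi (2 * rho)); [exact Hphi|].
  intros k. apply Hit. }
assert (Hphi_b : forall t, norm (phi t) <= rho).
{ intros t. apply Rminus_le, (le_of_geometric _ (2 * rho)). intros k.
  apply Rle_minus_l. eapply Rle_trans; [apply (norm_le_minus (phi t) (it k t))|].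
  rewrite Rplus_comm. apply Rplus_le_compat; [apply Hphi|apply Hit]. }
assert (HGphi : forall s, continuous (fun s => G (phi s)) s).
{ intros s. apply (lipschitz_ball_continuous G L rho); [exact HG|exact Hphi_b|apply Hphi_c]. }
exists phi. split; [exact Hphi_c|split; [exact Hphi_b|]].
(* For every k, both sides are within a multiple of (1/2)^k of the iterate k + 1. *)
assert (Hfix : forall t, phi t = Lam phi t).
{ intros t. apply minus_eq_zero_inv, norm_eq_zero, Rle_antisym; [|apply norm_ge_0].
  apply (le_of_geometric _ (2 * rho)). intros k.
  eapply Rle_trans; [apply (norm_dist_triangle _ (it (S k) t))|].
  assert (HK : 0 <= 2 * rho * (1 / 2) ^ k).
  { apply Rmult_le_pos; [lra|apply Rlt_le, Hpow]. }
  assert (H1 := Hphi (S k) t). simpl in H1.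
  assert (H2 : norm (minus (it (S k) t) (Lam phi t)) <= L * T * (2 * rho * (1 / 2) ^ k)).
  { apply (HLam_diff (it k) phi); try assumption; try apply Hit; try apply HGit.
    intros s. rewrite norm_minus_sym. apply Hphi. }
  assert (H3 : L * T * (2 * rho * (1 / 2) ^ k) <= 1 / 2 * (2 * rho * (1 / 2) ^ k))
    by (apply Rmult_le_compat_r; assumption).
  assert (Hr : forall a b c d e : R, a <= 2 * c * (1 / 2 * d) -> b <= e -> e <= 1 / 2 * (2 * c * d) ->
    a + b <= 2 * c * d) by (intros; lra).
  exact (Hr _ _ _ _ _ H1 H2 H3). }
intros t Ht.
replace (minus (phi t) (expA A t x0)) with (duhamelA A (fun s => G (phi s)) t).
- apply (is_RInt_duhamelA A (fun s => G (phi s))); assumption.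
- rewrite (Hfix t). unfold Lam. rewrite clamp_id; [|exact Ht].
  rewrite minus_plus_l. reflexivity.
Qed.

(** With K the supremum of the distance over [0, T], the Duhamel formula gives K <= |x0 - y0| + L T
    K, and L T <= 1/2 absorbs the last term; no Gronwall argument is involved. The common bound rho
    makes K finite. *)
Lemma mild_stable (A G : V -> V) (L rho T : R) (x0 y0 : V) (phi psi : R -> V) : skew A ->
  0 < T -> 0 <= L -> L * T <= 1 / 2 ->
  (forall x y, norm x <= rho -> norm y <= rho ->
     norm (minus (G x) (G y)) <= L * norm (minus x y)) ->
  (forall t, 0 <= t <= T -> norm (phi t) <= rho) ->
  (forall t, 0 <= t <= T -> norm (psi t) <= rho) ->
  mild A G x0 T phi -> mild A G y0 T psi ->
  forall t, 0 <= t <= T -> norm (minus (phi t) (psi t)) <= 2 * norm (minus x0 y0).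
Proof.
intros HA HT HL HLT HG Hb1 Hb2 Hphi Hpsi.
pose (E := fun r => exists t, 0 <= t <= T /\ r = norm (minus (phi t) (psi t))).
assert (Hbound : bound E).
{ exists (rho + rho). intros r [t [Ht ->]].
  eapply Rle_trans; [apply: norm_minus_le|].
  apply Rplus_le_compat; [apply Hb1|apply Hb2]; exact Ht. }
destruct (completeness E Hbound) as [K [HK1 HK2]].
{ exists (norm (minus (phi 0) (psi 0))), 0. split; [lra|reflexivity]. }
assert (HK : forall t, 0 <= t <= T -> norm (minus (phi t) (psi t)) <= K).
{ intros t Ht. apply HK1. exists t. split; [exact Ht|reflexivity]. }
assert (HK0 : 0 <= K).
{ eapply Rle_trans; [apply: norm_ge_0|apply (HK 0); lra]. }
assert (Hle : K <= norm (minus x0 y0) + 1 / 2 * K).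
{ apply HK2. intros r [t [Ht ->]].
  assert (HI := is_RInt_minus _ _ _ _ _ _ (Hphi t Ht) (Hpsi t Ht)).
  assert (HI' : norm (minus (minus (phi t) (expA A t x0)) (minus (psi t) (expA A t y0)))
                <= t * (L * K)).
  { apply (is_RInt_duhamel_norm A (fun s => minus (G (phi s)) (G (psi s))) t); [exact HA|apply Ht| |].
    - intros s Hs. eapply Rle_trans; [apply HG; [apply Hb1|apply Hb2]; lra|].
      apply Rmult_le_compat_l; [exact HL|]. apply HK; lra.
    - eapply is_RInt_ext; [|exact HI]. intros s _. symmetry.
      apply (is_linear_minus (expA A (t - s))), expA_linear, HA. }
  replace (minus (phi t) (psi t)) with
    (plus (minus (expA A t x0) (expA A t y0))
       (minus (minus (phi t) (expA A t x0)) (minus (psi t) (expA A t y0)))).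
  2:{ rewrite -minus_plus_plus !plus_minus_r. reflexivity. }
  eapply Rle_trans; [apply: norm_triangle|].
  rewrite -(is_linear_minus _ _ _ (expA_linear A t HA)) expA_norm; [|exact HA].
  apply Rplus_le_compat_l. eapply Rle_trans; [exact HI'|].
  replace (t * (L * K)) with (L * t * K) by ring.
  apply Rmult_le_compat_r; [exact HK0|].
  eapply Rle_trans; [|exact HLT]. apply Rmult_le_compat_l; [exact HL|apply Ht]. }
intros t Ht. eapply Rle_trans; [apply HK, Ht|]. lra.
Qed.

End Mild.

(** * Square-summable sequences *)

(* Sum over the window [-1-N, N]. *)
Definition zsum (f : Z -> R) (N : nat) : R :=
  sum_n (fun k => f (Z.of_nat k)) N + sum_n (fun k => f (- 1 - Z.of_nat k)%Z) N.

Lemma zsum_0 (f : Z -> R) : zsum f 0 = f 0%Z + f (-1)%Z.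
Proof. unfold zsum. rewrite !sum_O. reflexivity. Qed.

Lemma zsum_S (f : Z -> R) (N : nat) :
  zsum f (S N) = zsum f N + f (Z.of_nat (S N)) + f (- 1 - Z.of_nat (S N))%Z.
Proof. unfold zsum. rewrite !sum_Sn. unfold plus; simpl. ring. Qed.

Lemma zsum_ext (f g : Z -> R) (N : nat) : (forall n, f n = g n) -> zsum f N = zsum g N.
Proof. intros H. unfold zsum. f_equal; apply sum_n_ext; intros k; apply H. Qed.

Lemma zsum_le (f g : Z -> R) (N : nat) : (forall n, f n <= g n) -> zsum f N <= zsum g N.
Proof.
intros H. induction N as [|N IH].
- rewrite !zsum_0. apply Rplus_le_compat; apply H.
- rewrite !zsum_S. apply Rplus_le_compat; [apply Rplus_le_compat; [exact IH|]|]; apply H.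
Qed.

Lemma zsum_plus (f g : Z -> R) (N : nat) :
  zsum (fun n => f n + g n) N = zsum f N + zsum g N.
Proof. induction N as [|N IH]; [rewrite !zsum_0|rewrite !zsum_S IH]; ring. Qed.

Lemma zsum_scal (c : R) (f : Z -> R) (N : nat) :
  zsum (fun n => c * f n) N = c * zsum f N.
Proof. induction N as [|N IH]; [rewrite !zsum_0|rewrite !zsum_S IH]; ring. Qed.

Lemma zsum_nonneg (f : Z -> R) (N : nat) : (forall n, 0 <= f n) -> 0 <= zsum f N.
Proof.
intros H. replace 0 with (zsum (fun n => 0 * f n) N) by (rewrite zsum_scal; ring).
apply zsum_le. intros n. rewrite Rmult_0_l. apply H.
Qed.

Lemma zsum_incr (f : Z -> R) (N : nat) : (forall n, 0 <= f n) -> zsum f N <= zsum f (S N).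
Proof.
intros H. rewrite zsum_S.
assert (H1 := H (Z.of_nat (S N))). assert (H2 := H (- 1 - Z.of_nat (S N))%Z). lra.
Qed.

Lemma zsum_term_le (f : Z -> R) (n : Z) : (forall n, 0 <= f n) ->
  f n <= zsum f (Z.to_nat (Z.abs n)).
Proof.
intros H.
assert (Hk : forall N, f (Z.of_nat N) <= zsum f N /\ f (- 1 - Z.of_nat N)%Z <= zsum f N).
{ intros [|N].
  - rewrite zsum_0. assert (H1 := H 0%Z). assert (H2 := H (-1)%Z). simpl. lra.
  - rewrite zsum_S. assert (H1 := H (Z.of_nat (S N))).
    assert (H2 := H (- 1 - Z.of_nat (S N))%Z). assert (H3 := zsum_nonneg f N H). lra. }
destruct (Z_le_gt_dec 0 n) as [Hn|Hn].
- rewrite -{1}(Z2Nat.id n Hn) Z.abs_eq; [|exact Hn]. apply Hk.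
- destruct (Hk (Z.to_nat (- 1 - n))) as [_ H2].
  rewrite Z2Nat.id in H2; [|lia]. replace (-1 - (-1 - n))%Z with n in H2 by ring.
  eapply Rle_trans; [exact H2|].
  (* A negative site n is entry k = -1 - n = |n| - 1 of the second sum, one index before |n|. *)
  replace (Z.to_nat (Z.abs n)) with (S (Z.to_nat (- 1 - n))) by lia.
  apply zsum_incr, H.
Qed.

Lemma zsum_telescope (a : Z -> R) (N : nat) :
  zsum (fun n => a (n + 1)%Z - a n) N = a (Z.of_nat N + 1)%Z - a (- 1 - Z.of_nat N)%Z.
Proof.
induction N as [|N IH].
- rewrite zsum_0. simpl. ring.
- rewrite zsum_S IH. replace (Z.of_nat N + 1)%Z with (Z.of_nat (S N)) by lia.
  replace (-1 - Z.of_nat (S N) + 1)%Z with (-1 - Z.of_nat N)%Z by lia. ring.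
Qed.

(** The shifted windows [-N, N+1] and [-2-N, N-1] both lie in [-2-N, N+1]; telescoping makes this
    arithmetic. *)
Lemma zsum_shift_le (f : Z -> R) (N : nat) : (forall n, 0 <= f n) ->
  zsum (fun n => f (n + 1)%Z) N <= zsum f (S N) /\
  zsum (fun n => f (n - 1)%Z) N <= zsum f (S N).
Proof.
intros H. split.
- assert (E := zsum_telescope f N).
  rewrite (zsum_ext _ (fun n => f (n + 1)%Z + (-1) * f n)) in E; [|intros; ring].
  rewrite zsum_plus zsum_scal in E. rewrite zsum_S.
  replace (Z.of_nat (S N)) with (Z.of_nat N + 1)%Z by lia.
  assert (H1 := H (- 1 - Z.of_nat N)%Z). assert (H2 := H (- 1 - (Z.of_nat N + 1))%Z). lra.
- assert (E := zsum_telescope (fun n => f (n - 1)%Z) N).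
  rewrite (zsum_ext _ (fun n => f n + (-1) * f (n - 1)%Z)) in E;
    [|intros n; replace (n + 1 - 1)%Z with n by ring; ring].
  rewrite zsum_plus zsum_scal in E. rewrite zsum_S.
  replace (Z.of_nat N + 1 - 1)%Z with (Z.of_nat N) in E by ring.
  replace (-1 - Z.of_nat (S N))%Z with (- 1 - Z.of_nat N - 1)%Z by lia.
  assert (H1 := H (Z.of_nat N)). assert (H2 := H (Z.of_nat (S N))). lra.
Qed.

Lemma zsum_cauchy_schwarz (f g : Z -> R) (a b : R) (N : nat) : 0 <= a -> 0 <= b ->
  zsum (fun n => f n ^ 2) N <= a ^ 2 -> zsum (fun n => g n ^ 2) N <= b ^ 2 ->
  zsum (fun n => f n * g n) N <= a * b.
Proof.
intros Ha Hb Hf Hg.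
(* From 2 x y f g <= y^2 f^2 + x^2 g^2, divided by 2 x y. Since a and b may vanish, they are
   approached from above afterwards. *)
assert (Hpos : forall x y, 0 < x -> 0 < y -> a <= x -> b <= y ->
  zsum (fun n => f n * g n) N <= x * y).
{ intros x y Hx Hy Hax Hby.
  assert (H : zsum (fun n => (2 * x * y) * (f n * g n)) N
              <= zsum (fun n => y ^ 2 * f n ^ 2 + x ^ 2 * g n ^ 2) N).
  { apply zsum_le. intros n. assert (H := pow2_ge_0 (y * f n - x * g n)). lra. }
  rewrite zsum_plus !zsum_scal in H.
  assert (Hax2 : a ^ 2 <= x ^ 2) by (apply pow_incr; lra).
  assert (Hby2 : b ^ 2 <= y ^ 2) by (apply pow_incr; lra).
  assert (H1 : y ^ 2 * zsum (fun n => f n ^ 2) N <= y ^ 2 * x ^ 2).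
  { apply Rmult_le_compat_l; [apply pow2_ge_0|lra]. }
  assert (H2 : x ^ 2 * zsum (fun n => g n ^ 2) N <= x ^ 2 * y ^ 2).
  { apply Rmult_le_compat_l; [apply pow2_ge_0|lra]. }
  apply Rmult_le_reg_l with (2 * x * y).
  - repeat apply Rmult_lt_0_compat; lra.
  - eapply Rle_trans; [exact H|]. lra. }
apply le_epsilon. intros eps Heps.
(* (a + e)(b + e) - a b = e (a + b + e), at most e (a + b + 1) when e <= 1. *)
pose (e := Rmin 1 (eps / (a + b + 1))).
assert (He : 0 < e) by (apply Rmin_pos; [lra|apply Rdiv_lt_0_compat; lra]).
assert (He1 : e <= 1) by apply Rmin_l.
assert (He2 : e * (a + b + 1) <= eps).
{ apply Rle_trans with (eps / (a + b + 1) * (a + b + 1)); [|right; field; lra].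
  apply Rmult_le_compat_r; [lra|apply Rmin_r]. }
eapply Rle_trans; [apply (Hpos (a + e) (b + e)); lra|]. nra.
Qed.

(** * The l^2 norm through finite windows *)

Definition sq (u : zseq) : Z -> R := fun n => Cmod (u n) ^ 2.

Lemma sq_nonneg (u : zseq) (n : Z) : 0 <= sq u n.
Proof. apply pow2_ge_0. Qed.

(** Membership and bound travel together, since [ell2_norm] alone says nothing about a sequence that
    is not square-summable. *)
Definition l2le (u : zseq) (B : R) : Prop := ell2 u /\ ell2_norm u <= B.

Lemma ell2_norm_ge_0 (u : zseq) : 0 <= ell2_norm u.
Proof. apply sqrt_pos. Qed.

Lemma ell2_norm_sq (u : zseq) : ell2 u ->
  ell2_norm u ^ 2 = Series (fun k : nat => Cmod (u (Z.of_nat k)) ^ 2) +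
        Series (fun k : nat => Cmod (u (- 1 - Z.of_nat k)%Z) ^ 2).
Proof.
intros [H1 H2]. unfold ell2_norm. rewrite pow2_sqrt; [reflexivity|].
apply Rplus_le_le_0_compat.
- rewrite -(Rmult_0_l (Series (fun k => 0 * 0))) -Series_scal_l.
  apply Series_le; [|exact H1]. intros n. split; [lra|]. rewrite !Rmult_0_l. apply pow2_ge_0.
- rewrite -(Rmult_0_l (Series (fun k => 0 * 0))) -Series_scal_l.
  apply Series_le; [|exact H2]. intros n. split; [lra|]. rewrite !Rmult_0_l. apply pow2_ge_0.
Qed.

Lemma zsum_is_lim (u : zseq) : ell2 u -> is_lim_seq (zsum (sq u)) (ell2_norm u ^ 2).
Proof.
intros Hu. rewrite (ell2_norm_sq u Hu). destruct Hu as [H1 H2].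
apply is_lim_seq_plus'; [apply (Series_correct _ H1)|apply (Series_correct _ H2)].
Qed.

Lemma zsum_le_norm (u : zseq) (N : nat) : ell2 u -> zsum (sq u) N <= ell2_norm u ^ 2.
Proof.
intros Hu. apply is_lim_seq_incr_compare; [apply zsum_is_lim, Hu|].
intros n. apply zsum_incr, sq_nonneg.
Qed.

(** Monotone convergence: each half of a window is bounded by the whole, so both one-sided series
    converge. This reduces l^2 estimates to finite sums. *)
Lemma l2le_of_zsum (u : zseq) (B : R) : 0 <= B ->
  (forall N, zsum (sq u) N <= B ^ 2) -> l2le u B.
Proof.
intros HB H.
assert (Hpos : forall (f : nat -> Z) N, 0 <= sum_n (fun k => sq u (f k)) N).
{ intros f. induction N as [|N IH]; [rewrite sum_O|rewrite sum_Sn].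
  - apply sq_nonneg.
  - apply Rplus_le_le_0_compat; [exact IH|apply sq_nonneg]. }
assert (Hex : forall f : nat -> Z, (forall N, sum_n (fun k => sq u (f k)) N <= B ^ 2) ->
  ex_series (fun k => sq u (f k))).
{ intros f Hf. destruct (ex_finite_lim_seq_incr (sum_n (fun k => sq u (f k))) (B ^ 2)) as [l Hl].
  - intros n. rewrite sum_Sn. assert (H0 := sq_nonneg u (f (S n))).
    unfold plus; simpl. lra.
  - exact Hf.
  - exists l. exact Hl. }
assert (Hu : ell2 u).
{ split.
  - apply (Hex Z.of_nat). intros N. specialize (H N). unfold zsum in H.
    assert (H0 := Hpos (fun k => (- 1 - Z.of_nat k)%Z) N). cbv beta in H0. lra.
  - apply (Hex (fun k => (- 1 - Z.of_nat k)%Z)). intros N. specialize (H N). unfold zsum in H.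
    assert (H0 := Hpos Z.of_nat N). lra. }
split; [exact Hu|]. apply pow2_le_inv; [exact HB|].
apply (is_lim_seq_le (zsum (sq u)) (fun _ => B ^ 2) (ell2_norm u ^ 2) (B ^ 2) H).
- apply zsum_is_lim, Hu.
- apply is_lim_seq_const.
Qed.

Lemma l2le_ge_0 (u : zseq) (B : R) : l2le u B -> 0 <= B.
Proof. intros [_ H]. eapply Rle_trans; [apply ell2_norm_ge_0|exact H]. Qed.

Lemma l2le_zsum (u : zseq) (B : R) (N : nat) : l2le u B -> zsum (sq u) N <= B ^ 2.
Proof.
intros [Hu HB]. eapply Rle_trans; [apply zsum_le_norm, Hu|].
apply pow_incr. split; [apply ell2_norm_ge_0|exact HB].
Qed.

Lemma l2le_refl (u : zseq) : ell2 u -> l2le u (ell2_norm u).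
Proof. intros Hu. split; [exact Hu|apply Rle_refl]. Qed.

Lemma l2le_mono (u : zseq) (a b : R) : l2le u a -> a <= b -> l2le u b.
Proof. intros [Hu Ha] Hab. split; [exact Hu|lra]. Qed.

Lemma l2le_coord (u : zseq) (B : R) (n : Z) : l2le u B -> Cmod (u n) <= B.
Proof.
intros H. apply pow2_le_inv; [apply (l2le_ge_0 u), H|].
eapply Rle_trans; [apply (zsum_term_le (sq u)), sq_nonneg|]. apply l2le_zsum, H.
Qed.

Lemma zsum_minkowski (u v w : zseq) (a b : R) (N : nat) : 0 <= a -> 0 <= b ->
  zsum (sq u) N <= a ^ 2 -> zsum (sq v) N <= b ^ 2 ->
  (forall n, Cmod (w n) <= Cmod (u n) + Cmod (v n)) -> zsum (sq w) N <= (a + b) ^ 2.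
Proof.
intros Ha Hb Hu Hv Hw.
apply Rle_trans with (zsum (fun n => sq u n + (2 * (Cmod (u n) * Cmod (v n)) + sq v n)) N).
- apply zsum_le. intros n. unfold sq.
  apply Rle_trans with ((Cmod (u n) + Cmod (v n)) ^ 2); [|right; ring].
  apply pow_incr. split; [apply Cmod_ge_0|apply Hw].
- rewrite !zsum_plus zsum_scal.
  assert (H := zsum_cauchy_schwarz (fun n => Cmod (u n)) (fun n => Cmod (v n)) a b N Ha Hb Hu Hv).
  lra.
Qed.

(** Minkowski under mere pointwise domination, so that it also serves differences and nonlinear
    expressions. *)
Lemma l2le_plus (u v w : zseq) (a b : R) : l2le u a -> l2le v b ->
  (forall n, Cmod (w n) <= Cmod (u n) + Cmod (v n)) -> l2le w (a + b).
Proof.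
intros Hu Hv Hw. assert (Ha := l2le_ge_0 _ _ Hu). assert (Hb := l2le_ge_0 _ _ Hv).
apply l2le_of_zsum; [lra|]. intros N.
apply (zsum_minkowski u v); try assumption; apply l2le_zsum; assumption.
Qed.

Lemma l2le_dom (u v : zseq) (c b : R) : 0 <= c -> l2le v b ->
  (forall n, Cmod (u n) <= c * Cmod (v n)) -> l2le u (c * b).
Proof.
intros Hc Hv Huv. assert (Hb := l2le_ge_0 _ _ Hv).
apply l2le_of_zsum; [apply Rmult_le_pos; assumption|]. intros N.
apply Rle_trans with (zsum (fun n => c ^ 2 * sq v n) N).
- apply zsum_le. intros n. unfold sq. rewrite -Rpow_mult_distr.
  apply pow_incr. split; [apply Cmod_ge_0|apply Huv].
- rewrite zsum_scal Rpow_mult_distr. apply Rmult_le_compat_l; [apply pow2_ge_0|].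
  apply l2le_zsum, Hv.
Qed.

Lemma l2le_shift (u : zseq) (B : R) : l2le u B ->
  l2le (fun n => u (n + 1)%Z) B /\ l2le (fun n => u (n - 1)%Z) B.
Proof.
intros H. assert (HB := l2le_ge_0 _ _ H).
split; (apply l2le_of_zsum; [exact HB|]; intros N;
  eapply Rle_trans; [apply (zsum_shift_le (sq u)), sq_nonneg|apply l2le_zsum, H]).
Qed.

Lemma ell2_tends_0 (u : zseq) : ell2 u ->
  is_lim_seq (fun k => Cmod (u (Z.of_nat k))) 0 /\
  is_lim_seq (fun k => Cmod (u (- 1 - Z.of_nat k)%Z)) 0.
Proof.
assert (Hsq : forall f : nat -> R, (forall k, 0 <= f k) -> ex_series (fun k => f k ^ 2) ->
  is_lim_seq f 0).
{ intros f Hf Hs. apply ex_series_lim_0 in Hs.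
  apply is_lim_seq_ext with (fun k => sqrt (f k ^ 2)); [intros k; apply sqrt_pow2, Hf|].
  rewrite -sqrt_0. apply (filterlim_comp _ _ _ _ sqrt _ _ _ Hs). apply continuous_sqrt. }
intros [H1 H2]. split; apply Hsq; try assumption; intros k; apply Cmod_ge_0.
Qed.

(** Summation by parts on Z: the boundary terms are products of sequences tending to 0. *)
Lemma zsum_telescope_small (b : Z -> R) (v w : zseq) : ell2 v -> ell2 w ->
  (forall n, Rabs (b n) <= Cmod (v n) * Cmod (w n)) ->
  is_lim_seq (zsum (fun n => b (n + 1)%Z - b n)) 0.
Proof.
intros Hv Hw Hb.
(* The upper boundary term sits at N + 1, hence the shifted sequences. *)
assert (Hv' := proj1 (proj1 (l2le_shift v _ (l2le_refl v Hv)))).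
assert (Hw' := proj1 (proj1 (l2le_shift w _ (l2le_refl w Hw)))).
apply is_lim_seq_ext with (fun N => b (Z.of_nat N + 1)%Z - b (- 1 - Z.of_nat N)%Z).
{ intros N. symmetry. apply zsum_telescope. }
assert (Hbd : forall f g h : nat -> R, (forall k, Rabs (f k) <= g k * h k) ->
  is_lim_seq g 0 -> is_lim_seq h 0 -> is_lim_seq f 0).
{ intros f g h Hf Hg Hh. apply is_lim_seq_abs_0.
  apply (is_lim_seq_le_le (fun _ => 0) _ (fun k => g k * h k)).
  - intros k. split; [apply Rabs_pos|apply Hf].
  - apply is_lim_seq_const.
  - replace 0 with (0 * 0) by ring. apply (is_lim_seq_mult' g h 0 0 Hg Hh). }
replace 0 with (0 - 0) by ring. apply is_lim_seq_minus'.
- apply (Hbd _ _ _ (fun k => Hb (Z.of_nat k + 1)%Z)).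
  + apply (ell2_tends_0 _ Hv').
  + apply (ell2_tends_0 _ Hw').
- apply (Hbd _ _ _ (fun k => Hb (- 1 - Z.of_nat k)%Z)).
  + apply (ell2_tends_0 _ Hv).
  + apply (ell2_tends_0 _ Hw).
Qed.

Lemma Cmod_sq (z : C) : Cmod z ^ 2 = fst z ^ 2 + snd z ^ 2.
Proof.
unfold Cmod. rewrite pow2_sqrt; [reflexivity|].
apply Rplus_le_le_0_compat; apply pow2_ge_0.
Qed.

Lemma l2le_lap (u : zseq) (B : R) : l2le u B -> l2le (lap u) (4 * B).
Proof.
intros H. destruct (l2le_shift u B H) as [H1 H2].
replace (4 * B) with (B + B + 2 * B) by ring.
apply (l2le_plus (fun n => u (n + 1)%Z + u (n - 1)%Z)%C (fun n => RtoC 2 * u n)%C).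
- apply (l2le_plus _ _ _ _ _ H1 H2). intros n. apply Cmod_triangle.
- apply (l2le_dom _ u); [lra|exact H|]. intros n.
  rewrite Cmod_mult Cmod_R Rabs_pos_eq; lra.
- intros n. unfold lap, Cminus. eapply Rle_trans; [apply Cmod_triangle|].
  rewrite Cmod_opp. apply Rle_refl.
Qed.

(** These are the real and imaginary parts of z times the conjugate of w, and their squares add up
    to |z|^2 |w|^2. *)
Lemma Rabs_fst_snd_mult (z w : C) :
  Rabs (fst z * fst w + snd z * snd w) <= Cmod z * Cmod w /\
  Rabs (snd z * fst w - fst z * snd w) <= Cmod z * Cmod w.
Proof.
assert (H : (Cmod z * Cmod w) ^ 2 = (fst z ^ 2 + snd z ^ 2) * (fst w ^ 2 + snd w ^ 2))
  by (rewrite Rpow_mult_distr !Cmod_sq; reflexivity).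
assert (H0 : 0 <= Cmod z * Cmod w) by (apply Rmult_le_pos; apply Cmod_ge_0).
split; apply pow2_le_inv; try exact H0; rewrite H pow2_abs.
- assert (H1 := pow2_ge_0 (snd z * fst w - fst z * snd w)). lra.
- assert (H1 := pow2_ge_0 (fst z * fst w + snd z * snd w)). lra.
Qed.

(* <u, i Delta u> is purely imaginary: its real part telescopes. *)
Lemma ell2_pythagoras (u : zseq) (h : R) : ell2 u ->
  ell2 (fun n => u n + Ci * RtoC h * lap u n)%C /\
  ell2_norm (fun n => u n + Ci * RtoC h * lap u n)%C ^ 2
    = ell2_norm u ^ 2 + h ^ 2 * ell2_norm (lap u) ^ 2.
Proof.
intros Hu. assert (Hl := l2le_lap u _ (l2le_refl u Hu)).
set (w := (fun n => u n + Ci * RtoC h * lap u n)%C).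
assert (Hw : ell2 w).
{ eapply proj1. apply (l2le_plus u (fun n => Ci * RtoC h * lap u n)%C); [apply l2le_refl, Hu| |].
  - apply (l2le_dom _ (lap u) (Rabs h)); [apply Rabs_pos|exact Hl|].
    intros n. rewrite !Cmod_mult Cmod_R Cmod_Ci. lra.
  - intros n. apply Cmod_triangle. }
split; [exact Hw|].
(* The discrete current, Im of u n times the conjugate of u (n - 1). The cross term of |u + i h
   Delta u|^2 at n is -2 h (b (n + 1) - b n). *)
pose (b := fun n : Z => snd (u n) * fst (u (n - 1)%Z) - fst (u n) * snd (u (n - 1)%Z)).
assert (Hb : is_lim_seq (zsum (fun n => b (n + 1)%Z - b n)) 0).
{ apply (zsum_telescope_small b u (fun n => u (n - 1)%Z) Hu).
  - apply (l2le_shift u _ (l2le_refl u Hu)).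
  - intros n. apply Rabs_fst_snd_mult. }
assert (Heq : forall N, zsum (sq w) N =
  zsum (sq u) N + h ^ 2 * zsum (sq (lap u)) N + (- 2 * h) * zsum (fun n => b (n + 1)%Z - b n) N).
{ intros N. rewrite -!zsum_scal -!zsum_plus. apply zsum_ext. intros n.
  unfold sq, w. rewrite !Cmod_sq. unfold b, lap.
  replace (n + 1 - 1)%Z with n by ring.
  destruct (u n) as [x y]. destruct (u (n + 1)%Z) as [x1 y1]. destruct (u (n - 1)%Z) as [x2 y2].
  simpl. ring. }
assert (Hlim : is_lim_seq (zsum (sq w))
  (ell2_norm u ^ 2 + h ^ 2 * ell2_norm (lap u) ^ 2 + (- 2 * h) * 0)).
{ eapply is_lim_seq_ext; [intros N; symmetry; apply Heq|].
  apply is_lim_seq_plus'; [apply is_lim_seq_plus'|].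
  - apply zsum_is_lim, Hu.
  - apply (is_lim_seq_scal_l _ (h ^ 2) (ell2_norm (lap u) ^ 2)), zsum_is_lim, Hl.
  - apply (is_lim_seq_scal_l _ (- 2 * h) 0), Hb. }
assert (E := is_lim_seq_unique _ _ Hlim).
rewrite (is_lim_seq_unique _ _ (zsum_is_lim w Hw)) in E. apply Rbar_finite_eq in E. rewrite E. ring.
Qed.

Definition fdiff (u : zseq) : zseq := fun n => Cminus (u (n + 1)%Z) (u n).

Lemma l2le_fdiff (u : zseq) (B : R) : l2le u B -> l2le (fdiff u) (2 * B).
Proof.
intros H. destruct (l2le_shift u B H) as [H1 _]. replace (2 * B) with (B + B) by ring.
apply (l2le_plus _ _ _ _ _ H1 H). intros n. unfold fdiff, Cminus.
eapply Rle_trans; [apply Cmod_triangle|]. rewrite Cmod_opp. apply Rle_refl.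
Qed.

(** Summation by parts gives |D u|^2 = - Re <u, Delta u>; then Cauchy-Schwarz. *)
Lemma ell2_interpolation (u : zseq) : ell2 u ->
  ell2_norm (fdiff u) ^ 2 <= ell2_norm u * ell2_norm (lap u).
Proof.
intros Hu. assert (Hl := l2le_lap u _ (l2le_refl u Hu)).
assert (Hd := l2le_fdiff u _ (l2le_refl u Hu)).
assert (Hd' := l2le_shift _ _ (l2le_refl _ (proj1 Hd))).
pose (b := fun n : Z => fst (u n) * fst (fdiff u (n - 1)%Z) + snd (u n) * snd (fdiff u (n - 1)%Z)).
assert (Hb : is_lim_seq (zsum (fun n => b (n + 1)%Z - b n)) 0).
{ apply (zsum_telescope_small b u (fun n => fdiff u (n - 1)%Z) Hu).
  - apply Hd'.
  - intros n. apply Rabs_fst_snd_mult. }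
assert (Hle : forall N, zsum (sq (fdiff u)) N <=
  zsum (fun n => b (n + 1)%Z - b n) N + ell2_norm u * ell2_norm (lap u)).
{ intros N. apply Rle_trans with
    (zsum (fun n => (b (n + 1)%Z - b n) + Cmod (u n) * Cmod (lap u n)) N).
  - apply zsum_le. intros n.
    assert (H := proj1 (Rabs_fst_snd_mult (u n) (lap u n))).
    apply Rabs_le_between in H. destruct H as [H _].
    apply Rle_trans with ((b (n + 1)%Z - b n) -
      (fst (u n) * fst (lap u n) + snd (u n) * snd (lap u n))); [|lra].
    right. unfold sq. rewrite Cmod_sq. unfold b, fdiff, lap.
    replace (n + 1 - 1)%Z with n by ring. replace (n - 1 + 1)%Z with n by ring.
    destruct (u n) as [x y]. destruct (u (n + 1)%Z) as [x1 y1]. destruct (u (n - 1)%Z) as [x2 y2].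
    simpl. ring.
  - rewrite zsum_plus. apply Rplus_le_compat_l.
    apply zsum_cauchy_schwarz; try apply ell2_norm_ge_0.
    + apply (zsum_le_norm u N Hu).
    + apply (zsum_le_norm (lap u) N), Hl. }
assert (H := is_lim_seq_le _ _ (ell2_norm (fdiff u) ^ 2)
  (0 + ell2_norm u * ell2_norm (lap u)) Hle (zsum_is_lim _ (proj1 Hd))
  (is_lim_seq_plus' _ _ _ _ Hb (is_lim_seq_const _))).
simpl in H. lra.
Qed.

(** * l^2 as a complete normed module *)

Definition l2 : Type := {u : zseq | ell2 u}.
Definition coord (x : l2) : zseq := proj1_sig x.

Lemma coord_ell2 (x : l2) : ell2 (coord x).
Proof. exact (proj2_sig x). Qed.

Lemma l2_eq (x y : l2) : (forall n, coord x n = coord y n) -> x = y.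
Proof.
destruct x as [u Hu], y as [v Hv]. simpl. intros H.
assert (E : u = v) by (apply functional_extensionality; exact H).
subst v. f_equal. apply proof_irrelevance.
Qed.

Lemma ell2_plus (u v : zseq) : ell2 u -> ell2 v -> ell2 (fun n => u n + v n)%C.
Proof.
intros Hu Hv. eapply proj1, l2le_plus; [apply l2le_refl, Hu|apply l2le_refl, Hv|].
intros n. apply Cmod_triangle.
Qed.

Lemma ell2_scal (c : C) (u : zseq) : ell2 u -> ell2 (fun n => c * u n)%C.
Proof.
intros Hu. eapply proj1, (l2le_dom _ u (Cmod c)); [apply Cmod_ge_0|apply l2le_refl, Hu|].
intros n. rewrite Cmod_mult. apply Rle_refl.
Qed.

Lemma l2le_0 : l2le (fun _ => RtoC 0) 0.
Proof.
apply l2le_of_zsum; [lra|]. intros N. right.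
rewrite (zsum_ext _ (fun n => 0 * 0)); [rewrite zsum_scal; ring|].
intros n. unfold sq. rewrite Cmod_0. ring.
Qed.

Definition l2_zero : l2 := exist _ _ (proj1 l2le_0).
Definition l2_plus (x y : l2) : l2 :=
  exist _ _ (ell2_plus _ _ (coord_ell2 x) (coord_ell2 y)).
(** The module structure below is over the reals; complex multiplication stays available as an
    operator. *)
Definition l2_cmul (c : C) (x : l2) : l2 := exist _ _ (ell2_scal c _ (coord_ell2 x)).
Definition l2_opp (x : l2) : l2 := l2_cmul (RtoC (-1)) x.
Definition l2_norm (x : l2) : R := ell2_norm (coord x).

Definition l2_AbelianMonoid_mixin : AbelianMonoid.mixin_of l2.
Proof.
apply (AbelianMonoid.Mixin l2 l2_plus l2_zero); intros; apply l2_eq; intros n; simpl; ring.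
Defined.

Canonical l2_AbelianMonoid := AbelianMonoid.Pack l2 l2_AbelianMonoid_mixin l2.

Definition l2_AbelianGroup_mixin : AbelianGroup.mixin_of l2_AbelianMonoid.
Proof.
apply (AbelianGroup.Mixin _ l2_opp). intros x. apply l2_eq. intros n.
change (coord x n + RtoC (-1) * coord x n = RtoC 0)%C.
apply injective_projections; simpl; ring.
Defined.

Canonical l2_AbelianGroup :=
  AbelianGroup.Pack l2 (AbelianGroup.Class _ _ l2_AbelianGroup_mixin) l2.

Definition l2_ModuleSpace_mixin : ModuleSpace.mixin_of R_Ring l2_AbelianGroup.
Proof.
apply (ModuleSpace.Mixin R_Ring l2_AbelianGroup (fun c x => l2_cmul (RtoC c) x)).
- intros x y u. apply l2_eq. intros n. simpl. unfold mult; simpl.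
  rewrite RtoC_mult. ring.
- intros u. apply l2_eq. intros n. simpl. unfold one; simpl. ring.
- intros x u v. apply l2_eq. intros n. simpl. ring.
- intros x y u. apply l2_eq. intros n. simpl. unfold plus; simpl. rewrite RtoC_plus. ring.
Defined.

Canonical l2_ModuleSpace :=
  ModuleSpace.Pack R_Ring l2 (ModuleSpace.Class _ _ _ l2_ModuleSpace_mixin) l2.

Lemma coord_plus (x y : l2) (n : Z) : coord (plus x y) n = (coord x n + coord y n)%C.
Proof. reflexivity. Qed.

Lemma coord_scal (c : R) (x : l2) (n : Z) : coord (scal c x) n = (RtoC c * coord x n)%C.
Proof. reflexivity. Qed.

Lemma coord_minus (x y : l2) (n : Z) : coord (minus x y) n = (coord x n - coord y n)%C.
Proof.
change (coord x n + RtoC (-1) * coord y n = coord x n - coord y n)%C.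
apply injective_projections; simpl; ring.
Qed.

Lemma l2_norm_triangle (x y : l2) : l2_norm (plus x y) <= l2_norm x + l2_norm y.
Proof.
refine (proj2 (l2le_plus (coord x) (coord y) _ _ _ _ _ _));
  [apply l2le_refl, coord_ell2|apply l2le_refl, coord_ell2|].
intros n. apply Cmod_triangle.
Qed.

Lemma l2_norm_scal (c : R) (x : l2) : l2_norm (scal c x) <= Rabs c * l2_norm x.
Proof.
refine (proj2 (l2le_dom _ (coord x) (Rabs c) _ _ _ _));
  [apply Rabs_pos|apply l2le_refl, coord_ell2|].
intros n. rewrite coord_scal Cmod_mult Cmod_R. apply Rle_refl.
Qed.

Lemma l2_norm_coord (x : l2) (n : Z) : Cmod (coord x n) <= l2_norm x.
Proof. apply l2le_coord, l2le_refl, coord_ell2. Qed.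

Lemma l2_norm_eq_0 (x : l2) : l2_norm x = 0 -> x = zero.
Proof.
intros Hx. apply l2_eq. intros n. apply Cmod_eq_0, Rle_antisym; [|apply Cmod_ge_0].
rewrite -Hx. apply l2_norm_coord.
Qed.

Lemma l2_norm_minus_self (x : l2) : l2_norm (minus x x) = 0.
Proof.
apply Rle_antisym; [|apply ell2_norm_ge_0].
replace (minus x x) with (scal 0 x); [|apply l2_eq; intros n; rewrite coord_minus coord_scal; ring].
eapply Rle_trans; [apply l2_norm_scal|]. rewrite Rabs_R0. lra.
Qed.

Definition l2_ball (x : l2) (eps : R) (y : l2) : Prop := l2_norm (minus y x) < eps.

Definition l2_UniformSpace_mixin : UniformSpace.mixin_of l2.
Proof.
apply (UniformSpace.Mixin l2 l2_zero l2_ball).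
- intros x [eps Heps]. unfold l2_ball. rewrite l2_norm_minus_self. exact Heps.
- intros x y e H. unfold l2_ball in *.
  replace (minus x y) with (scal (-1) (minus y x)).
  + eapply Rle_lt_trans; [apply l2_norm_scal|].
    rewrite Rabs_Ropp Rabs_R1 Rmult_1_l. exact H.
  + apply l2_eq. intros n. rewrite coord_scal !coord_minus. apply injective_projections; simpl; ring.
- intros x y z e1 e2 H1 H2. unfold l2_ball in *.
  replace (minus z x) with (plus (minus z y) (minus y x)).
  + eapply Rle_lt_trans; [apply l2_norm_triangle|]. lra.
  + apply l2_eq. intros n. rewrite coord_plus !coord_minus. ring.
Defined.

Canonical l2_UniformSpace := UniformSpace.Pack l2 l2_UniformSpace_mixin l2.

Canonical l2_NormedModuleAux :=
  NormedModuleAux.Pack R_AbsRing l2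
    (NormedModuleAux.Class R_AbsRing l2 (ModuleSpace.class R_Ring l2_ModuleSpace)
       (UniformSpace.class l2_UniformSpace)) l2.

Definition l2_NormedModule_mixin : NormedModule.mixin_of R_AbsRing l2_NormedModuleAux.
Proof.
apply (NormedModule.Mixin R_AbsRing l2_NormedModuleAux l2_norm 1).
- exact l2_norm_triangle.
- exact l2_norm_scal.
- intros x y eps H. exact H.
- intros x y eps H. rewrite Rmult_1_l. exact H.
- exact l2_norm_eq_0.
Defined.

Canonical l2_NormedModule :=
  NormedModule.Pack R_AbsRing l2
    (NormedModule.Class _ _ _ l2_NormedModule_mixin) l2.

(* The limit is taken coordinatewise; [l2_zero] is a junk value for filters
   that are not Cauchy. *)
Definition l2_lim_coord (F : (l2 -> Prop) -> Prop) : zseq :=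
  fun n => lim (T := C_R_CompleteNormedModule) (fun P => F (fun x => P (coord x n))).

Definition l2_lim (F : (l2 -> Prop) -> Prop) : l2 :=
  match excluded_middle_informative (ell2 (l2_lim_coord F)) with
  | left H => exist _ _ H
  | right _ => l2_zero
  end.

Lemma l2_lim_coord_close (F : (l2 -> Prop) -> Prop) (n : Z) (d : R) :
  ProperFilter F -> cauchy F -> 0 < d ->
  F (fun x => Cmod (coord x n - l2_lim_coord F n) < d).
Proof.
intros FF HF Hd.
assert (Hd2 : 0 < d / 2) by lra.
assert (HC : ProperFilter (filtermap (fun x : l2 => coord x n) F))
  by apply filtermap_proper_filter, FF.
assert (HCc : cauchy (T := C_UniformSpace) (filtermap (fun x : l2 => coord x n) F)).
{ intros eps. destruct (HF eps) as [x0 Hx0]. exists (coord x0 n).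
  unfold filtermap. revert Hx0. apply filter_imp. intros x Hx.
  assert (H : Cmod (coord x n - coord x0 n) < eps).
  { eapply Rle_lt_trans; [|exact Hx]. rewrite -coord_minus. apply l2_norm_coord. }
  assert (H1 := Rmax_Cmod (coord x n - coord x0 n)%C).
  split.
  - eapply Rle_lt_trans; [|exact H]. eapply Rle_trans; [|exact H1]. apply Rmax_l.
  - eapply Rle_lt_trans; [|exact H]. eapply Rle_trans; [|exact H1]. apply Rmax_r. }
generalize (complete_cauchy (T := C_R_CompleteNormedModule) _ HC HCc (mkposreal _ Hd2)).
unfold filtermap. apply filter_imp. intros x [H1 H2].
change (Rabs (fst (coord x n) - fst (l2_lim_coord F n)) < d / 2) in H1.
change (Rabs (snd (coord x n) - snd (l2_lim_coord F n)) < d / 2) in H2.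
apply Rlt_le_trans with (d / 2 + d / 2); [|lra].
eapply Rle_lt_trans; [|apply Rplus_lt_compat; [exact H1|exact H2]].
apply pow2_le_inv; [apply Rplus_le_le_0_compat; apply Rabs_pos|].
rewrite Cmod_sq. set (a := Rabs _). set (b := Rabs _).
assert (Ha : 0 <= a) by apply Rabs_pos. assert (Hb : 0 <= b) by apply Rabs_pos.
apply Rle_trans with (a ^ 2 + b ^ 2).
- right. unfold a, b. rewrite !pow2_abs. reflexivity.
- assert (H := Rmult_le_pos _ _ Ha Hb). lra.
Qed.

(** A filter is closed under finite intersections only, so coordinatewise closeness is summed over a
    finite window. *)
Lemma l2_lim_window_close (F : (l2 -> Prop) -> Prop) (N : nat) :
  ProperFilter F -> cauchy F -> forall d, 0 < d ->
  F (fun x => zsum (sq (fun n => l2_lim_coord F n - coord x n)%C) N <= d).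
Proof.
intros FF HF.
assert (Hone : forall n d, 0 < d -> F (fun x => sq (fun n => l2_lim_coord F n - coord x n)%C n <= d)).
{ intros n d Hd.
  generalize (l2_lim_coord_close F n (sqrt d) FF HF (sqrt_lt_R0 _ Hd)).
  apply filter_imp. intros x Hx. unfold sq.
  rewrite -Cmod_opp -(pow2_sqrt d); [|lra].
  apply pow_incr. split; [apply Cmod_ge_0|].
  replace (- (l2_lim_coord F n - coord x n))%C with (coord x n - l2_lim_coord F n)%C by ring.
  lra. }
induction N as [|N IH]; intros d Hd.
- assert (Hd2 : 0 < d / 2) by lra.
  generalize (filter_and _ _ (Hone 0%Z _ Hd2) (Hone (-1)%Z _ Hd2)).
  apply filter_imp. intros x [H1 H2]. rewrite zsum_0. lra.
- assert (Hd3 : 0 < d / 3) by lra.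
  generalize (filter_and _ _ (IH _ Hd3) (filter_and _ _
    (Hone (Z.of_nat (S N)) _ Hd3) (Hone (- 1 - Z.of_nat (S N))%Z _ Hd3))).
  apply filter_imp. intros x [H1 [H2 H3]]. rewrite zsum_S. lra.
Qed.

(** A Fatou argument: F contains a ball of radius eps / 2 about some x0. On each window the
    coordinatewise limit is arbitrarily close to a point of that ball, so its distance to x0 is at
    most eps / 2 on every window, hence in l^2. *)
Lemma l2_complete (F : (l2 -> Prop) -> Prop) :
  ProperFilter F -> cauchy F -> forall eps : posreal, F (l2_ball (l2_lim F) eps).
Proof.
intros FF HF [eps Heps]. simpl.
destruct (HF (mkposreal (eps / 2) ltac:(lra))) as [x0 Hx0]. simpl in Hx0.
assert (Hd : l2le (fun n => l2_lim_coord F n - coord x0 n)%C (eps / 2)).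
{ apply l2le_of_zsum; [lra|]. intros N.
  assert (Hall : forall d, 0 < d ->
    zsum (sq (fun n => l2_lim_coord F n - coord x0 n)%C) N <= (d + eps / 2) ^ 2).
  { intros d Hd.
    destruct (filter_ex _ (filter_and _ _ Hx0
      (l2_lim_window_close F N FF HF (d ^ 2) (pow_lt d 2 Hd)))) as [x [H1 H2]].
    apply (zsum_minkowski (fun n => l2_lim_coord F n - coord x n)%C (coord (minus x x0)));
      [lra|lra|exact H2| |].
    - apply l2le_zsum. split; [apply coord_ell2|]. apply Rlt_le. exact H1.
    - intros n. rewrite coord_minus. eapply Rle_trans; [|apply Cmod_triangle].
      right. f_equal. ring. }
  apply le_epsilon. intros e He.
  (* (m + eps / 2)^2 exceeds (eps / 2)^2 by m (m + eps), at most m (1 + eps) when m <= 1. *)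
  assert (Hm : 0 < Rmin 1 (e / (1 + eps))) by (apply Rmin_pos; [lra|apply Rdiv_lt_0_compat; lra]).
  eapply Rle_trans; [apply (Hall _ Hm)|].
  set (m := Rmin 1 (e / (1 + eps))) in *.
  assert (Hm1 : m <= 1) by apply Rmin_l.
  assert (Hm2 : m * (1 + eps) <= e).
  { apply Rle_trans with (e / (1 + eps) * (1 + eps)); [|right; field; lra].
    apply Rmult_le_compat_r; [lra|apply Rmin_r]. }
  nra. }
assert (Hl : ell2 (l2_lim_coord F)).
{ eapply proj1, l2le_plus; [exact Hd|apply l2le_refl, (coord_ell2 x0)|].
  intros n. eapply Rle_trans; [|apply Cmod_triangle]. right. f_equal. ring. }
revert Hx0. apply filter_imp. intros x Hx. unfold l2_ball, l2_lim.
destruct excluded_middle_informative as [Hl'|Hn]; [|contradiction].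
replace (minus x (exist _ _ Hl' : l2)) with
  (minus (minus x x0) (exist _ _ (proj1 Hd) : l2)).
- eapply Rle_lt_trans.
  + refine (proj2 (l2le_plus _ _ _ _ _ (l2le_refl _ (coord_ell2 (minus x x0))) Hd _)).
    intros n. rewrite coord_minus. eapply Rle_trans; [apply Cmod_triangle|].
    rewrite Cmod_opp. apply Rle_refl.
  + assert (Hx' : ell2_norm (coord (minus x x0)) < eps / 2) by exact Hx. lra.
- apply l2_eq. intros n. rewrite !coord_minus. simpl. ring.
Qed.

Definition l2_CompleteSpace_mixin : CompleteSpace.mixin_of l2_UniformSpace.
Proof.
apply (CompleteSpace.Mixin l2_UniformSpace l2_lim).
- exact l2_complete.
(* Filters with the same members are equal by extensionality, so they have the same limit. *)
- intros F1 F2 H1 H2. replace F2 with F1; [intros eps; apply ball_center|].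
  apply functional_extensionality. intros P. apply propositional_extensionality.
  split; [apply H2|apply H1].
Defined.

Canonical l2_CompleteNormedModule :=
  CompleteNormedModule.Pack R_AbsRing l2
    (CompleteNormedModule.Class _ _ (NormedModule.class _ l2_NormedModule)
       l2_CompleteSpace_mixin) l2.

Lemma l2_normE (x : l2) : norm x = ell2_norm (coord x).
Proof. reflexivity. Qed.

(** The bridge to the componentwise statement: with [is_RInt_linear] and [is_series_linear],
    coordinates of l^2 integrals and series are scalar ones. *)
Lemma coord_linear (n : Z) :
  is_linear (U := l2_NormedModule) (V := C_R_NormedModule) (fun x => coord x n).
Proof.
split.
- intros x y. reflexivity.
- intros c x. apply injective_projections; unfold scal; simpl; unfold mult, scal; simpl; unfold mult; simpl; ring.
- exists 1. split; [lra|]. intros x. rewrite Rmult_1_l.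
  eapply Rle_trans; [right|apply (l2_norm_coord x n)].
  unfold norm; simpl. unfold prod_norm, Cmod, norm; simpl. unfold abs; simpl.
  rewrite !Rmult_1_r. f_equal.
  change (Rabs (fst (coord x n)) * Rabs (fst (coord x n)) + Rabs (snd (coord x n)) * Rabs (snd (coord x n)) = fst (coord x n) * fst (coord x n) + snd (coord x n) * snd (coord x n)).
  rewrite -!Rabs_mult !Rabs_pos_eq; [reflexivity|apply Rle_0_sqr|apply Rle_0_sqr].
Qed.

(** * The Schroedinger group on l^2 *)

Lemma l2le_skew_lap (kappa : R) (u : zseq) (B : R) : l2le u B ->
  l2le (fun n => Ci * RtoC kappa * lap u n)%C (Rabs kappa * (4 * B)).
Proof.
intros H. apply (l2le_dom _ (lap u)); [apply Rabs_pos|apply l2le_lap, H|].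
intros n. rewrite !Cmod_mult Cmod_R Cmod_Ci. lra.
Qed.

Lemma l2le_skew_fdiff (kappa : R) (u : zseq) (B : R) : l2le u B ->
  l2le (fun n => Ci * RtoC kappa * fdiff u n)%C (Rabs kappa * (2 * B)).
Proof.
intros H. apply (l2le_dom _ (fdiff u)); [apply Rabs_pos|apply l2le_fdiff, H|].
intros n. rewrite !Cmod_mult Cmod_R Cmod_Ci. lra.
Qed.

Definition skew_lap (kappa : R) (x : l2) : l2 :=
  exist _ _ (proj1 (l2le_skew_lap kappa _ _ (l2le_refl _ (coord_ell2 x)))).

(** Not itself skew: it shares with [skew_lap] the factor i kappa, so that its value at zeta' is i
    kappa Delta zeta. *)
Definition skew_fdiff (kappa : R) (x : l2) : l2 :=
  exist _ _ (proj1 (l2le_skew_fdiff kappa _ _ (l2le_refl _ (coord_ell2 x)))).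

Lemma skew_lap_linear (kappa : R) : is_linear (skew_lap kappa).
Proof.
split.
- intros x y. apply l2_eq. intros n. rewrite coord_plus. simpl. unfold lap. simpl. ring.
- intros c x. apply l2_eq. intros n. rewrite coord_scal. simpl. unfold lap. simpl. ring.
- exists (Rabs kappa * 4 + 1). split; [generalize (Rabs_pos kappa); lra|]. intros x.
  assert (H := proj2 (l2le_skew_lap kappa _ _ (l2le_refl _ (coord_ell2 x)))).
  rewrite !l2_normE. eapply Rle_trans; [exact H|].
  generalize (ell2_norm_ge_0 (coord x)). lra.
Qed.

Lemma skew_fdiff_linear (kappa : R) : is_linear (skew_fdiff kappa).
Proof.
split.
- intros x y. apply l2_eq. intros n. rewrite coord_plus. simpl. unfold fdiff. simpl. ring.
- intros c x. apply l2_eq. intros n. rewrite coord_scal. simpl. unfold fdiff. simpl. ring.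
- exists (Rabs kappa * 2 + 1). split; [generalize (Rabs_pos kappa); lra|]. intros x.
  assert (H := proj2 (l2le_skew_fdiff kappa _ _ (l2le_refl _ (coord_ell2 x)))).
  rewrite !l2_normE. eapply Rle_trans; [exact H|].
  generalize (ell2_norm_ge_0 (coord x)). lra.
Qed.

Lemma skew_lap_fdiff_comm (kappa : R) (x : l2) :
  skew_lap kappa (skew_fdiff kappa x) = skew_fdiff kappa (skew_lap kappa x).
Proof.
apply l2_eq. intros n. simpl. unfold lap, fdiff. simpl. unfold lap.
replace (n - 1 + 1)%Z with n by ring. replace (n + 1 - 1)%Z with n by ring. ring.
Qed.

Lemma skew_lap_skew (kappa : R) : skew (skew_lap kappa).
Proof.
(* 16 is the square of the bound 4 for the norm of [lap]. *)
split; [apply skew_lap_linear|]. exists (16 * kappa ^ 2).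
split; [generalize (pow2_ge_0 kappa); lra|]. intros x h. rewrite !l2_normE.
destruct (ell2_pythagoras (coord x) (h * kappa) (coord_ell2 x)) as [_ H].
assert (E : coord (plus x (scal h (skew_lap kappa x))) =
  (fun n => coord x n + Ci * RtoC (h * kappa) * lap (coord x) n)%C).
{ apply functional_extensionality. intros n. rewrite coord_plus coord_scal. simpl.
  rewrite RtoC_mult. ring. }
eapply Rle_trans; [right; exact (f_equal (fun w => ell2_norm w ^ 2) E)|].
rewrite H. assert (Hl := proj2 (l2le_lap _ _ (l2le_refl _ (coord_ell2 x)))).
assert (H2 : ell2_norm (lap (coord x)) ^ 2 <= (4 * ell2_norm (coord x)) ^ 2).
{ apply pow_incr. split; [apply ell2_norm_ge_0|exact Hl]. }
apply Rmult_le_compat_l with (r := (h * kappa) ^ 2) in H2; [|apply pow2_ge_0]. lra.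
Qed.

Lemma coord_iter_skew_lap (kappa : R) (k : nat) (x : l2) (n : Z) :
  coord (Nat.iter k (skew_lap kappa) x) n
  = ((Ci * RtoC kappa) ^ k * Nat.iter k lap (coord x) n)%C.
Proof.
revert n. induction k as [|k IH]; intros n; simpl Nat.iter.
- simpl. ring.
- change (coord (skew_lap kappa (Nat.iter k (skew_lap kappa) x)) n)
    with (Ci * RtoC kappa * lap (coord (Nat.iter k (skew_lap kappa) x)) n)%C.
  rewrite Cpow_S. unfold lap at 1 2. rewrite !IH. ring.
Qed.

Lemma CSeries_unique (a : nat -> C) (s : C) :
  is_series (V := C_R_NormedModule) a s -> CSeries a = s.
Proof.
intros H. apply injective_projections; simpl; apply is_series_unique.
- apply (is_series_linear (U := C_R_NormedModule) (V := R_NormedModule) fst);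
    [apply is_linear_fst|exact H].
- apply (is_series_linear (U := C_R_NormedModule) (V := R_NormedModule) snd);
    [apply is_linear_snd|exact H].
Qed.

Lemma exp_lap_expA (kappa t : R) (x : l2) (n : Z) :
  exp_lap (kappa * t) (coord x) n = coord (expA (skew_lap kappa) t x) n.
Proof.
apply CSeries_unique.
apply is_series_ext with (fun k => coord (expA_term (skew_lap kappa) t x k) n).
- intros k. unfold expA_term. rewrite coord_scal coord_iter_skew_lap.
  rewrite RtoC_mult !Cpow_mult_l RtoC_div; [|apply INR_fact_neq_0].
  rewrite RtoC_pow. refine (_ : @eq C _ _). field. intros H. apply (INR_fact_neq_0 k), RtoC_inj, H.
- apply (is_series_linear (fun y => coord y n) _ _ (coord_linear n)).
  apply (expA_correct (V := l2_CompleteNormedModule)), skew_lap_linear.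
Qed.

(** * Algebra of the Duhamel integral and the sqrt t estimate *)

Section Convolution.
Context {V : CompleteNormedModule R_AbsRing} (A : V -> V) (HA : skew A).

Lemma duhamelA_unique (f : R -> V) (t : R) (I : V) : (forall s, continuous f s) ->
  is_RInt (fun s => expA A (t - s) (f s)) 0 t I -> duhamelA A f t = I.
Proof.
intros Hf HI. rewrite -(is_RInt_unique _ _ _ _ HI). symmetry.
apply is_RInt_unique, is_RInt_duhamelA; assumption.
Qed.

Lemma duhamelA_plus (f g : R -> V) (t : R) :
  (forall s, continuous f s) -> (forall s, continuous g s) ->
  duhamelA A (fun s => plus (f s) (g s)) t = plus (duhamelA A f t) (duhamelA A g t).
Proof.
intros Hf Hg. apply duhamelA_unique.
- intros s. apply: continuous_plus; [apply Hf|apply Hg].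
- eapply is_RInt_ext; [|apply: is_RInt_plus; apply is_RInt_duhamelA; [exact HA|exact Hf|exact HA|exact Hg]].
  intros s _. symmetry. apply expA_plus, HA.
Qed.

Lemma duhamelA_comm (B : V -> V) (x : V) (t : R) : is_linear B ->
  (forall y, A (B y) = B (A y)) ->
  duhamelA A (fun _ => B x) t = B (duhamelA A (fun _ => x) t).
Proof.
intros HB HAB. apply duhamelA_unique; [intros s; apply continuous_const|].
apply is_RInt_ext with (fun s => B (expA A (t - s) x)).
- intros s _. symmetry. apply expA_comm; [apply HA|exact HB|exact HAB].
- apply (is_RInt_linear B); [exact HB|].
  apply (is_RInt_duhamelA A (fun _ => x)); [exact HA|intros s; apply continuous_const].
Qed.

(** A exp((t-s)A) x is minus the s-derivative of exp((t-s)A) x; integrate from 0 to t. *)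
Lemma generator_duhamelA_const (x : V) (t : R) :
  A (duhamelA A (fun _ => x) t) = minus (expA A t x) x.
Proof.
assert (H1 : is_RInt (fun s => A (expA A (t - s) x)) 0 t (A (duhamelA A (fun _ => x) t))).
{ apply (is_RInt_linear A); [apply HA|].
  apply (is_RInt_duhamelA A (fun _ => x)); [exact HA|intros s; apply continuous_const]. }
assert (H2 : is_RInt (fun s => opp (A (expA A (t - s) x))) 0 t (minus (expA A (t - t) x) (expA A (t - 0) x))).
{ apply (is_RInt_derive (fun s => expA A (t - s) x)).
  - intros s _. replace (opp (A (expA A (t - s) x))) with (scal (-1) (A (expA A (t - s) x))).
    + apply: (is_derive_comp (fun q => expA A q x) (fun q => t - q)).
      * apply is_derive_expA, HA.
      * auto_derive; [exact I|ring].
    + exact (scal_opp_one (K := R_Ring) _).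
  - intros s _. apply: continuous_opp.
    apply (continuous_comp (fun s => expA A (t - s) x) A).
    + apply (expA_continuous A (fun s => t - s) (fun _ => x)); [exact HA| |apply continuous_const].
      apply (continuous_minus (V := R_NormedModule) (fun _ => t) (fun s => s)); [apply continuous_const|apply continuous_id].
    + apply: linear_cont; apply HA. }
rewrite Rminus_diag Rminus_0_r expA_0 in H2; [|apply HA].
assert (H3 := is_RInt_opp _ _ _ _ H2).
apply (is_RInt_ext _ (fun s => A (expA A (t - s) x))) in H3; [|intros s _; apply opp_opp].
rewrite -(is_RInt_unique _ _ _ _ H1) (is_RInt_unique _ _ _ _ H3). exact (opp_minus _ _).
Qed.

End Convolution.

(* The convolution of [i kappa fdiff z] is [i kappa fdiff g] with
   [g = int_0^t U(t-s) z ds].  Interpolate between [|g| <= t |z|] and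
   [kappa |lap g| = |U(t) z - z| <= 2 |z|]. *)
Lemma duhamelA_fdiff_norm (kappa t : R) (z : l2) : 0 < kappa -> 0 <= t ->
  norm (duhamelA (skew_lap kappa) (fun _ => skew_fdiff kappa z) t)
  <= sqrt (2 * kappa) * norm z * sqrt t.
Proof.
intros Hk Ht. assert (HA := skew_lap_skew kappa).
rewrite (duhamelA_comm _ HA _ z t (skew_fdiff_linear kappa) (skew_lap_fdiff_comm kappa)).
set (g := duhamelA (skew_lap kappa) (fun _ => z) t).
assert (Hg : norm g <= t * norm z).
{ apply (is_RInt_duhamel_norm (skew_lap kappa) (fun _ => z) t); [exact HA|exact Ht| |].
  - intros s _. apply Rle_refl.
  - apply (is_RInt_duhamelA (skew_lap kappa) (fun _ => z)); [exact HA|intros s; apply continuous_const]. }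
assert (HAg : norm (skew_lap kappa g) <= 2 * norm z).
{ unfold g. rewrite (generator_duhamelA_const _ HA).
  eapply Rle_trans; [apply: norm_minus_le|]. rewrite expA_norm; [|exact HA]. change (norm z + norm z <= 2 * norm z). lra. }
assert (Hlap : ell2_norm (lap (coord g)) <= / kappa * norm (skew_lap kappa g)).
{ refine (proj2 (l2le_dom _ (coord (skew_lap kappa g)) _ _ _ _ _)).
  - apply Rlt_le, Rinv_0_lt_compat, Hk.
  - apply l2le_refl, coord_ell2.
  - intros n. simpl. rewrite !Cmod_mult Cmod_R Cmod_Ci Rabs_pos_eq; [|lra].
    right. field. lra. }
assert (HBg : norm (skew_fdiff kappa g) <= kappa * ell2_norm (fdiff (coord g))).
{ refine (proj2 (l2le_dom _ (fdiff (coord g)) _ _ _ _ _)); [lra| |].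
  - apply l2le_refl. eapply proj1, l2le_fdiff, l2le_refl, coord_ell2.
  - intros n. simpl. rewrite !Cmod_mult Cmod_R Cmod_Ci Rabs_pos_eq; lra. }
assert (Hint := ell2_interpolation (coord g) (coord_ell2 g)).
assert (Hz : 0 <= norm z) by apply: norm_ge_0.
apply pow2_le_inv; [repeat apply Rmult_le_pos; try apply sqrt_pos; exact Hz|].
rewrite !Rpow_mult_distr (pow2_sqrt (2 * kappa)) ?(pow2_sqrt t); [|exact Ht|lra].
apply Rle_trans with ((kappa * ell2_norm (fdiff (coord g))) ^ 2).
{ apply pow_incr. split; [apply: norm_ge_0|exact HBg]. }
rewrite Rpow_mult_distr.
(* kappa^2 times t |z| times 2 |z| / kappa is 2 kappa t |z|^2, the origin of sqrt(2 kappa) sqrt t in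
   the radius. *)
apply Rle_trans with (kappa ^ 2 * ((t * norm z) * (/ kappa * (2 * norm z)))).
- apply Rmult_le_compat_l; [apply pow2_ge_0|]. eapply Rle_trans; [exact Hint|].
  apply Rmult_le_compat; [apply ell2_norm_ge_0|apply ell2_norm_ge_0|exact Hg|].
  eapply Rle_trans; [exact Hlap|]. apply Rmult_le_compat_l; [|exact HAg].
  apply Rlt_le, Rinv_0_lt_compat, Hk.
- right. field. lra.
Qed.

(** * Estimates for the nonlinearity *)

Lemma rpow_ge_0 (x a : R) : 0 <= rpow x a.
Proof. unfold rpow. destruct Rlt_dec; [apply Rlt_le, exp_pos|lra]. Qed.

Lemma rpow_le (x y a : R) : 0 <= a -> x <= y -> rpow x a <= rpow y a.
Proof.
intros Ha Hxy. unfold rpow at 1. destruct Rlt_dec as [Hx|Hx]; [|apply rpow_ge_0].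
unfold rpow. destruct Rlt_dec; [|lra]. apply Rle_Rpower_l; lra.
Qed.

Lemma rpow_S (x a : R) : 0 <= x -> rpow x (a + 1) = rpow x a * x.
Proof.
intros Hx. unfold rpow. destruct Rlt_dec; [|lra].
rewrite Rpower_plus Rpower_1; [reflexivity|assumption].
Qed.

Lemma rpow_lipschitz (q rho a b : R) : 1 <= q -> 0 <= a <= rho -> 0 <= b <= rho ->
  Rabs (rpow a q - rpow b q) <= q * rpow rho (q - 1) * Rabs (a - b).
Proof.
intros Hq.
assert (Hord : forall a b, 0 <= a -> a < b -> b <= rho ->
  0 <= rpow b q - rpow a q <= q * rpow rho (q - 1) * (b - a)).
{ clear a b. intros a b Ha Hab Hb. split; [assert (H := rpow_le a b q); lra|].
  assert (Hr := rpow_ge_0 rho (q - 1)).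
  destruct (Rle_lt_or_eq_dec 0 a Ha) as [Ha0|<-].
  - destruct (MVT_gen (fun x => Rpower x q) a b (fun c => q * Rpower c (q - 1))) as [c [Hc E]].
    + intros c Hc. rewrite Rmin_left in Hc; [|lra]. apply is_derive_Reals, derivable_pt_lim_power. lra.
    + intros c Hc. rewrite Rmin_left in Hc; [|lra].
      apply derivable_continuous_pt. exists (q * Rpower c (q - 1)).
      apply derivable_pt_lim_power. lra.
    + rewrite Rmin_left in Hc; [|lra]. rewrite Rmax_right in Hc; [|lra].
      unfold rpow at 1 2. destruct Rlt_dec; [|lra]. destruct Rlt_dec; [|lra].
      rewrite E. apply Rmult_le_compat_r; [lra|]. apply Rmult_le_compat_l; [lra|].
      unfold rpow. destruct Rlt_dec; [|lra]. apply Rle_Rpower_l; lra.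
  - replace (rpow 0 q) with 0; [|unfold rpow; destruct Rlt_dec; lra].
    replace q with (q - 1 + 1) at 1 by ring. rewrite rpow_S; [|lra].
    assert (H1 : rpow b (q - 1) <= rpow rho (q - 1)) by (apply rpow_le; lra).
    assert (H2 : rpow b (q - 1) * b <= rpow rho (q - 1) * b) by (apply Rmult_le_compat_r; lra).
    assert (H3 : 0 <= (q - 1) * (rpow rho (q - 1) * b)).
    { apply Rmult_le_pos; [lra|apply Rmult_le_pos; lra]. }
    lra. }
intros [Ha1 Ha2] [Hb1 Hb2]. destruct (Rtotal_order a b) as [H|[->|H]].
- specialize (Hord a b Ha1 H Hb2). rewrite Rabs_minus_sym (Rabs_minus_sym a) !Rabs_pos_eq; lra.
- rewrite !Rminus_diag Rabs_R0. lra.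
- specialize (Hord b a Hb1 H Ha2). rewrite !Rabs_pos_eq; lra.
Qed.

(* The part of [forcing] without [kappa Delta zeta], as a function of
   [u = phi + zeta]. *)
Definition nonlin (mu q0 p : R) (u : zseq) : zseq := fun n =>
  (- (RtoC (mu * rpow q0 (2 * p)) * u n)
   + RtoC (mu / 2 * rpow (Cmod (u n)) (2 * p)) * (u (n + 1)%Z + u (n - 1)%Z))%C.

Lemma forcing_nonlin (kappa mu q0 p : R) (zeta phi : zseq) (n : Z) :
  forcing kappa mu q0 p zeta phi n
  = (RtoC kappa * lap zeta n + nonlin mu q0 p (seq_add phi zeta) n)%C.
Proof. unfold forcing, nonlin. ring. Qed.

(** Here rho bounds |phi + zeta|. In 2p + 1, the 2p comes from the variation of the modulus power
    and the 1 from that of the two neighbours. *)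
Definition lip_const (mu q0 p rho : R) : R :=
  Rabs mu * (rpow q0 (2 * p) + (2 * p + 1) * rpow rho (2 * p)).

Lemma nonlin_lipschitz (mu q0 p rho d : R) (u v : zseq) : 1 <= p ->
  (forall n, Cmod (u n) <= rho) -> (forall n, Cmod (v n) <= rho) ->
  l2le (seq_sub u v) d ->
  l2le (seq_sub (nonlin mu q0 p u) (nonlin mu q0 p v)) (lip_const mu q0 p rho * d).
Proof.
intros Hp Hu Hv Hd. set (w := seq_sub u v) in *.
assert (Hrho : 0 <= rho) by (eapply Rle_trans; [apply (Cmod_ge_0 (u 0%Z))|apply Hu]).
set (a := rpow q0 (2 * p)). set (b := rpow rho (2 * p)).
assert (Ha : 0 <= a) by apply rpow_ge_0. assert (Hb : 0 <= b) by apply rpow_ge_0.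
assert (Hmu := Rabs_pos mu).
assert (Hab : 0 <= Rabs mu * (a + 2 * p * b)).
{ apply Rmult_le_pos; [exact Hmu|]. apply Rplus_le_le_0_compat; [exact Ha|].
  apply Rmult_le_pos; lra. }
assert (Hmb : 0 <= Rabs mu * b / 2).
{ apply Rmult_le_pos; [apply Rmult_le_pos; assumption|lra]. }
destruct (l2le_shift w d Hd) as [H1 H2].
replace (lip_const mu q0 p rho * d) with
  (Rabs mu * (a + 2 * p * b) * d + Rabs mu * b / 2 * (d + d));
  [|unfold lip_const; fold a b; field].
apply (l2le_plus (fun n => RtoC (Rabs mu * (a + 2 * p * b)) * w n)%C
  (fun n => RtoC (Rabs mu * b / 2 * (Cmod (w (n + 1)%Z) + Cmod (w (n - 1)%Z))))).
- apply (l2le_dom _ w); [exact Hab|exact Hd|]. intros n.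
  rewrite Cmod_mult Cmod_R Rabs_pos_eq; [|exact Hab]. apply Rle_refl.
- apply (l2le_dom _ (fun n => RtoC (Cmod (w (n + 1)%Z) + Cmod (w (n - 1)%Z)))); [exact Hmb| |].
  + apply (l2le_plus _ _ _ _ _ H1 H2). intros n. rewrite Cmod_R Rabs_pos_eq; [apply Rle_refl|].
    apply Rplus_le_le_0_compat; apply Cmod_ge_0.
  + intros n. rewrite RtoC_mult Cmod_mult Cmod_R (Rabs_pos_eq _ Hmb). apply Rle_refl.
- intros n.
  pose (gu := rpow (Cmod (u n)) (2 * p)). pose (gv := rpow (Cmod (v n)) (2 * p)).
  (* Product rule for differences: vary the modulus factor against the neighbours of v, then the
     neighbours against the modulus factor of u. *)
  replace (seq_sub (nonlin mu q0 p u) (nonlin mu q0 p v) n) with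
    (- (RtoC (mu * a) * w n) + (RtoC (mu / 2 * (gu - gv)) * (v (n + 1)%Z + v (n - 1)%Z)
      + RtoC (mu / 2 * gu) * (w (n + 1)%Z + w (n - 1)%Z)))%C.
  2:{ unfold w, seq_sub, nonlin. fold gu gv a. rewrite !RtoC_mult RtoC_minus. ring. }
  eapply Rle_trans; [apply Cmod_triangle|].
  eapply Rle_trans; [apply Rplus_le_compat_l, Cmod_triangle|].
  rewrite Cmod_opp !Cmod_mult !Cmod_R !Rabs_mult.
  assert (Hgu : gu <= b) by (apply rpow_le; [lra|apply Hu]).
  assert (Hgu0 : 0 <= gu) by apply rpow_ge_0.
  (* The factor rho comes from the neighbours of v and completes rho^(2p-1) to rho^(2p). *)
  assert (Hg : Rabs (gu - gv) * rho <= 2 * p * b * Cmod (w n)).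
  { apply Rle_trans with (2 * p * rpow rho (2 * p - 1) * Cmod (w n) * rho).
    - apply Rmult_le_compat_r; [exact Hrho|].
      eapply Rle_trans.
      + apply (rpow_lipschitz (2 * p) rho); [lra| |];
          (split; [apply Cmod_ge_0|]); [apply Hu|apply Hv].
      + apply Rmult_le_compat_l; [apply Rmult_le_pos; [lra|apply rpow_ge_0]|].
        apply Rabs_le. split.
        * assert (H := Cmod_triangle (u n) (v n - u n)%C).
          replace (u n + (v n - u n))%C with (v n) in H by ring.
          replace (v n - u n)%C with (- w n)%C in H by (unfold w, seq_sub; ring).
          rewrite Cmod_opp in H. lra.
        * assert (H := Cmod_triangle (v n) (w n)).
          replace (v n + w n)%C with (u n) in H by (unfold w, seq_sub; ring). lra.
    - right. replace b with (rpow rho (2 * p - 1) * rho); [ring|].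
      rewrite -rpow_S; [|exact Hrho]. unfold b. f_equal. ring. }
  assert (Hvv : Cmod (v (n + 1)%Z + v (n - 1)%Z)%C <= 2 * rho).
  { eapply Rle_trans; [apply Cmod_triangle|]. assert (H3 := Hv (n + 1)%Z). assert (H4 := Hv (n - 1)%Z). lra. }
  assert (Hww := Cmod_triangle (w (n + 1)%Z) (w (n - 1)%Z)).
  assert (Hw1 := Cmod_ge_0 (w (n + 1)%Z)). assert (Hw2 := Cmod_ge_0 (w (n - 1)%Z)).
  rewrite (Rabs_pos_eq a Ha) (Rabs_pos_eq gu Hgu0) Rabs_Rabsolu.
  rewrite (Rabs_pos_eq (a + 2 * p * b)); [|apply Rplus_le_le_0_compat; [exact Ha|apply Rmult_le_pos; lra]].
  rewrite (Rabs_pos_eq b Hb) (Rabs_pos_eq (Cmod (w (n + 1)%Z) + Cmod (w (n - 1)%Z))); [|lra].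
  replace (Rabs (mu / 2)) with (Rabs mu / 2); [|rewrite Rabs_div; [rewrite (Rabs_pos_eq 2); lra|lra]].
  replace (Rabs (/ 2)) with (/ 2); [|rewrite Rabs_pos_eq; lra].
  assert (Hx : Rabs mu / 2 * Rabs (gu - gv) * Cmod (v (n + 1)%Z + v (n - 1)%Z)%C
    <= Rabs mu * (2 * p * b * Cmod (w n))).
  { apply Rle_trans with (Rabs mu / 2 * Rabs (gu - gv) * (2 * rho)).
    - apply Rmult_le_compat_l; [|exact Hvv]. apply Rmult_le_pos; [lra|apply Rabs_pos].
    - apply Rmult_le_compat_l with (r := Rabs mu) in Hg; [|exact Hmu]. lra. }
  assert (Hy : Rabs mu / 2 * gu * Cmod (w (n + 1)%Z + w (n - 1)%Z)%C
    <= Rabs mu / 2 * b * (Cmod (w (n + 1)%Z) + Cmod (w (n - 1)%Z))).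
  { apply Rmult_le_compat; [apply Rmult_le_pos; lra|apply Cmod_ge_0| |exact Hww].
    apply Rmult_le_compat_l; lra. }
  lra.
Qed.

Lemma lap_fdiff_bdiff (u : zseq) (n : Z) : lap u n = fdiff (bdiff u) n.
Proof. unfold lap, fdiff, bdiff. replace (n + 1 - 1)%Z with n by ring. ring. Qed.

(** Replacing |zeta|^(2p) by q0^(2p) turns the expression into (mu/2) q0^(2p) Delta zeta, controlled
    by zeta'; the error carries |zeta|^(2p) - q0^(2p), controlled by |zeta| - q0. *)
Lemma nonlin_background (mu q0 p m d e : R) (zeta : zseq) : 1 <= p -> 0 <= q0 ->
  (forall n, Cmod (zeta n) <= m) -> l2le (bdiff zeta) d ->
  l2le (modulus_defect q0 zeta) e ->
  l2le (nonlin mu q0 p zeta)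
    (Rabs mu * (2 * p * rpow (m + q0 + e) (2 * p + 1) + rpow q0 (2 * p) * d)).
Proof.
intros Hp Hq0 Hm Hd He.
assert (Hmu := Rabs_pos mu). assert (He0 := l2le_ge_0 _ _ He).
assert (Hm0 : 0 <= m) by (eapply Rle_trans; [apply (Cmod_ge_0 (zeta 0%Z))|apply Hm]).
set (s := m + q0 + e). assert (Hs : m <= s /\ q0 <= s /\ e <= s) by (unfold s; lra).
set (a := rpow q0 (2 * p)). assert (Ha : 0 <= a) by apply rpow_ge_0.
set (c := rpow s (2 * p - 1)). assert (Hc : 0 <= c) by apply rpow_ge_0.
assert (Hma : 0 <= Rabs mu * a / 2) by (apply Rmult_le_pos; [apply Rmult_le_pos; assumption|lra]).
assert (Hmc : 0 <= Rabs mu * (2 * p * c * m)).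
{ apply Rmult_le_pos; [exact Hmu|]. apply Rmult_le_pos; [apply Rmult_le_pos; lra|exact Hm0]. }
assert (Hlap : l2le (lap zeta) (2 * d)).
{ replace (lap zeta) with (fdiff (bdiff zeta)); [apply l2le_fdiff, Hd|].
  apply functional_extensionality. intros n. symmetry. apply lap_fdiff_bdiff. }
apply l2le_mono with (Rabs mu * (2 * p * c * m) * e + Rabs mu * a / 2 * (2 * d)).
- apply (l2le_plus (fun n => RtoC (Rabs mu * (2 * p * c * m)) * modulus_defect q0 zeta n)%C
    (fun n => RtoC (mu * a / 2) * lap zeta n)%C).
  + apply (l2le_dom _ (modulus_defect q0 zeta)); [exact Hmc|exact He|]. intros n.
    rewrite Cmod_mult Cmod_R (Rabs_pos_eq _ Hmc). apply Rle_refl.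
  + apply (l2le_dom _ (lap zeta)); [exact Hma|exact Hlap|]. intros n.
    rewrite Cmod_mult Cmod_R. unfold Rdiv. rewrite !Rabs_mult (Rabs_pos_eq a Ha) (Rabs_pos_eq (/ 2)); lra.
  + intros n. pose (g := rpow (Cmod (zeta n)) (2 * p)).
    replace (nonlin mu q0 p zeta n) with
      (RtoC (mu / 2 * (g - a)) * (zeta (n + 1)%Z + zeta (n - 1)%Z) + RtoC (mu * a / 2) * lap zeta n)%C.
    2:{ unfold nonlin, lap. fold g a. apply injective_projections; simpl; field. }
    eapply Rle_trans; [apply Cmod_triangle|]. apply Rplus_le_compat_r.
    rewrite !Cmod_mult !Cmod_R (Rabs_pos_eq _ Hmc).
    assert (Hg : Rabs (g - a) <= 2 * p * c * Rabs (Cmod (zeta n) - q0)).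
    { apply rpow_lipschitz; [lra| |lra]. split; [apply Cmod_ge_0|].
      eapply Rle_trans; [apply Hm|lra]. }
    assert (Hz : Cmod (zeta (n + 1)%Z + zeta (n - 1)%Z)%C <= 2 * m).
    { eapply Rle_trans; [apply Cmod_triangle|]. assert (H3 := Hm (n + 1)%Z). assert (H4 := Hm (n - 1)%Z). lra. }
    apply Rle_trans with (Rabs (mu / 2 * (g - a)) * (2 * m)).
    { apply Rmult_le_compat_l; [apply Rabs_pos|exact Hz]. }
    rewrite Rabs_mult.
    replace (Rabs (mu / 2)) with (Rabs mu / 2); [|rewrite Rabs_div; [rewrite (Rabs_pos_eq 2); lra|lra]].
    assert (Hmm : 0 <= Rabs mu * m) by (apply Rmult_le_pos; assumption).
    apply Rmult_le_compat_l with (r := Rabs mu * m) in Hg; [|exact Hmm]. lra.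
- replace (2 * p + 1) with (2 * p - 1 + 1 + 1) by ring.
  rewrite !rpow_S; try lra. fold c.
  (* s dominates m, q0 and e at once, so s^(2p-1) m e <= s^(2p+1), the single power in the
     radius. *)
  assert (Hms : m * e <= s * s) by (apply Rmult_le_compat; lra).
  assert (Hk : 0 <= Rabs mu * (2 * p * c)).
  { apply Rmult_le_pos; [exact Hmu|apply Rmult_le_pos; lra]. }
  apply Rmult_le_compat_l with (r := Rabs mu * (2 * p * c)) in Hms; [|exact Hk]. lra.
Qed.

(** * The Duhamel equation on l^2 *)

(** [real] sends both infinities to 0; a member and an upper bound of E exclude them. *)
Lemma Lub_Rbar_real_bounds (E : R -> Prop) (x K : R) : E x -> (forall y, E y -> y <= K) ->
  x <= real (Lub_Rbar E) <= K.
Proof.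
intros Hx HK. destruct (Lub_Rbar_correct E) as [Hub Hlub].
assert (H1 : Rbar_le x (Lub_Rbar E)) by exact (Hub x Hx).
assert (H2 : Rbar_le (Lub_Rbar E) K) by (apply Hlub; intros y Hy; exact (HK y Hy)).
destruct (Lub_Rbar E) as [l| |]; simpl in *; [split; assumption|contradiction|contradiction].
Qed.

Lemma ellinf_norm_ge (u : zseq) (n : Z) : ellinf u -> Cmod (u n) <= ellinf_norm u.
Proof.
intros [K HK]. apply (Lub_Rbar_real_bounds _ (Cmod (u n)) K).
- exists n. reflexivity.
- intros y [m ->]. apply HK.
Qed.

Lemma ell2_seq_lim_0 (u : zseq) : ell2 u ->
  seq_lim_pinf u (RtoC 0) /\ seq_lim_minf u (RtoC 0).
Proof.
intros Hu.
assert (Hlim : forall v : nat -> C, is_lim_seq (fun k => Cmod (v k)) 0 ->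
  filterlim v eventually (locally (RtoC 0))).
{ intros v Hv P [eps HP].
  destruct (proj2 (is_lim_seq_spec _ _) Hv eps) as [N HN].
  exists N. intros k Hk. apply HP. specialize (HN k Hk).
  rewrite Rminus_0_r Rabs_pos_eq in HN; [|apply Cmod_ge_0].
  assert (Hm := Rmax_Cmod (v k)).
  split; [change (Rabs (fst (v k) - 0) < eps)|change (Rabs (snd (v k) - 0) < eps)];
    rewrite Rminus_0_r; (eapply Rle_lt_trans; [|exact HN]);
    (eapply Rle_trans; [|exact Hm]); [apply Rmax_l|apply Rmax_r]. }
split; apply Hlim.
- apply (ell2_tends_0 u Hu).
(* The limit at minus infinity runs over -k, the half sum over -1 - k: shift by one. *)
- assert (Hs := proj1 (proj1 (l2le_shift u _ (l2le_refl u Hu)))).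
  apply (is_lim_seq_ext (fun k => Cmod (u (- 1 - Z.of_nat k + 1)%Z))).
  + intros k. f_equal. f_equal. ring.
  + apply (ell2_tends_0 _ Hs).
Qed.

Lemma cont_ell2_lift (T : R) (psi : R -> zseq) : 0 < T -> cont_ell2 T psi ->
  exists Psi : R -> l2, (forall t, continuous Psi t) /\
    forall t, coord (Psi t) = psi (clamp T t).
Proof.
intros HT Hpsi.
pose (Psi := fun t => exist _ _ (proj1 (Hpsi _ (clamp_range T t (Rlt_le _ _ HT)))) : l2).
exists Psi. split; [|reflexivity]. intros t.
refine (proj2 (continuous_norm_iff (V := l2_NormedModule) _ _) _). intros eps Heps.
destruct (Hpsi _ (clamp_range T t (Rlt_le _ _ HT))) as [_ Hlim].
assert (Hball : locally 0 (fun r : R => r < eps)).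
{ exists (mkposreal eps Heps). intros r Hr. change (Rabs (r - 0) < eps) in Hr.
  apply Rabs_lt_between in Hr. simpl in Hr. lra. }
specialize (Hlim _ Hball).
assert (Hloc := clamp_continuous T t _ Hlim). revert Hloc. unfold filtermap.
apply filter_imp. intros s Hs.
specialize (Hs (clamp_range T s (Rlt_le _ _ HT))).
eapply Rle_lt_trans; [right|exact Hs].
rewrite l2_normE. f_equal. apply functional_extensionality. intros n. apply coord_minus.
Qed.

Lemma cont_ell2_coord (T : R) (Phi : R -> l2) : (forall t, continuous Phi t) ->
  cont_ell2 T (fun t => coord (Phi t)).
Proof.
intros Hc t Ht. split; [apply coord_ell2|].
intros P [eps HP]. apply filter_le_within.
generalize (proj1 (continuous_norm_iff (V := l2_NormedModule) Phi t) (Hc t) eps (cond_pos eps)).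
apply filter_imp. intros s Hs. apply HP.
change (Rabs (ell2_norm (seq_sub (coord (Phi s)) (coord (Phi t))) - 0) < eps).
rewrite Rminus_0_r Rabs_pos_eq; [|apply ell2_norm_ge_0].
eapply Rle_lt_trans; [right|exact Hs].
rewrite l2_normE. f_equal. apply functional_extensionality. intros n. symmetry. apply coord_minus.
Qed.

Lemma closed_ball_lift (T rho : R) (psi : R -> zseq) : 0 < T -> closed_ball T rho psi ->
  exists Psi : R -> l2, (forall t, continuous Psi t) /\ (forall t, norm (Psi t) <= rho) /\
    forall t, 0 <= t <= T -> coord (Psi t) = psi t.
Proof.
intros HT [Hc Hsup]. destruct (cont_ell2_lift T psi HT Hc) as [Psi [HPc HPsi]].
exists Psi. split; [exact HPc|]. split.
- intros t. eapply Rle_trans; [|exact Hsup].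
  (* Compactness makes the supremum finite; only then does a bound on [sup_norm] bound each
     value. *)
  destruct (bounded_continuity (V := l2_NormedModule) Psi 0 T (fun x _ => HPc x)) as [K HK].
  apply (Lub_Rbar_real_bounds _ _ K).
  + exists (clamp T t). split; [apply clamp_range; lra|]. rewrite l2_normE HPsi. reflexivity.
  + intros y [s [Hs ->]]. apply Rlt_le. specialize (HK s Hs).
    rewrite l2_normE HPsi clamp_id in HK; [exact HK|exact Hs].
- intros t Ht. rewrite HPsi clamp_id; [reflexivity|exact Ht].
Qed.

Lemma l2_cmul_linear (c : C) : is_linear (l2_cmul c).
Proof.
split.
- intros x y. apply l2_eq. intros n. rewrite coord_plus. simpl. ring.
- intros a x. apply l2_eq. intros n. rewrite coord_scal. simpl. ring.
- exists (Cmod c + 1). split; [generalize (Cmod_ge_0 c); lra|]. intros x.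
  rewrite !l2_normE. apply Rle_trans with (Cmod c * ell2_norm (coord x)).
  + refine (proj2 (l2le_dom _ (coord x) _ _ _ _ _));
      [apply Cmod_ge_0|apply l2le_refl, coord_ell2|].
    intros n. simpl. rewrite Cmod_mult. apply Rle_refl.
  + generalize (ell2_norm_ge_0 (coord x)). lra.
Qed.

Lemma skew_lap_cmul_comm (kappa : R) (c : C) (x : l2) :
  skew_lap kappa (l2_cmul c x) = l2_cmul c (skew_lap kappa x).
Proof. apply l2_eq. intros n. simpl. unfold lap. simpl. ring. Qed.

Section Equation.
Context (kappa mu q0 p : R) (zeta : zseq).
Context (kappa_pos : 0 < kappa) (q0_pos : 0 < q0) (p_ge1 : 1 <= p).
Context (zeta_inf : ellinf zeta) (zeta_diff : ell2 (bdiff zeta))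
  (zeta_defect : ell2 (modulus_defect q0 zeta)).

Let m := ellinf_norm zeta.

Lemma background_bound (n : Z) : Cmod (zeta n) <= m.
Proof. apply ellinf_norm_ge, zeta_inf. Qed.

Lemma seq_add_bound (rho : R) (x : l2) (n : Z) : norm x <= rho ->
  Cmod (seq_add (coord x) zeta n) <= rho + m.
Proof.
intros Hx. eapply Rle_trans; [apply Cmod_triangle|].
apply Rplus_le_compat; [|apply background_bound].
eapply Rle_trans; [apply l2_norm_coord|exact Hx].
Qed.

Lemma forcing_lipschitz (rho : R) (x y : l2) : norm x <= rho -> norm y <= rho ->
  l2le (seq_sub (forcing kappa mu q0 p zeta (coord x)) (forcing kappa mu q0 p zeta (coord y)))
    (lip_const mu q0 p (rho + m) * norm (minus x y)).
Proof.
intros Hx Hy.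
assert (H := nonlin_lipschitz mu q0 p (rho + m) (norm (minus x y))
  (seq_add (coord x) zeta) (seq_add (coord y) zeta) p_ge1
  (fun n => seq_add_bound rho x n Hx) (fun n => seq_add_bound rho y n Hy)).
replace (seq_sub (forcing kappa mu q0 p zeta (coord x)) (forcing kappa mu q0 p zeta (coord y)))
  with (seq_sub (nonlin mu q0 p (seq_add (coord x) zeta)) (nonlin mu q0 p (seq_add (coord y) zeta))).
- apply H. replace (seq_sub (seq_add (coord x) zeta) (seq_add (coord y) zeta))
    with (coord (minus x y)); [apply l2le_refl, coord_ell2|].
  apply functional_extensionality. intros n. rewrite coord_minus. unfold seq_sub, seq_add. ring.
- apply functional_extensionality. intros n. unfold seq_sub. rewrite !forcing_nonlin. ring.
Qed.

Let dn := ell2_norm (bdiff zeta).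
Let nl0 := Rabs mu * (2 * p * rpow (m + q0 + ell2_norm (modulus_defect q0 zeta)) (2 * p + 1)
             + rpow q0 (2 * p) * dn).

Lemma nonlin_background_l2le : l2le (nonlin mu q0 p zeta) nl0.
Proof.
apply nonlin_background; [exact p_ge1|lra|exact background_bound|apply l2le_refl, zeta_diff|].
apply l2le_refl, zeta_defect.
Qed.

Lemma forcing_zero (n : Z) :
  forcing kappa mu q0 p zeta (coord zero) n
  = (RtoC kappa * fdiff (bdiff zeta) n + nonlin mu q0 p zeta n)%C.
Proof.
rewrite forcing_nonlin lap_fdiff_bdiff. f_equal. f_equal.
apply functional_extensionality. intros k. unfold seq_add. simpl. ring.
Qed.

(** The terms cannot be treated one by one, since zeta is not in l^2: forcing(0) is in l^2 through
    zeta' and |zeta| - q0, and forcing(x) - forcing(0) by the Lipschitz bound. *)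
Lemma forcing_ell2 (x : l2) : ell2 (forcing kappa mu q0 p zeta (coord x)).
Proof.
assert (H0 : ell2 (forcing kappa mu q0 p zeta (coord zero))).
{ eapply proj1, (l2le_plus (fun n => RtoC kappa * fdiff (bdiff zeta) n)%C (nonlin mu q0 p zeta)).
  - apply l2le_refl, ell2_scal. eapply proj1, l2le_fdiff, l2le_refl, zeta_diff.
  - apply nonlin_background_l2le.
  - intros n. rewrite forcing_zero. apply Cmod_triangle. }
assert (Hz : norm (zero : l2) <= norm x) by (rewrite (norm_zero (V := l2_NormedModule)); apply norm_ge_0).
assert (H := forcing_lipschitz (norm x) x zero (Rle_refl _) Hz).
eapply proj1, l2le_plus; [exact H|apply l2le_refl, H0|].
intros n. eapply Rle_trans; [|apply Cmod_triangle]. right. f_equal. unfold seq_sub. ring.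
Qed.

Let A := skew_lap kappa.

Definition l2_forcing (x : l2) : l2 := exist _ _ (forcing_ell2 x).
Definition l2_rhs (x : l2) : l2 := l2_cmul Ci (l2_forcing x).

Lemma l2_rhs_lipschitz (rho : R) (x y : l2) : norm x <= rho -> norm y <= rho ->
  norm (minus (l2_rhs x) (l2_rhs y)) <= lip_const mu q0 p (rho + m) * norm (minus x y).
Proof.
intros Hx Hy. rewrite -[X in _ <= X]Rmult_1_l (l2_normE (minus (l2_rhs x) _)).
refine (proj2 (l2le_dom _ _ _ _ _ (forcing_lipschitz rho x y Hx Hy) _)); [lra|].
intros n. rewrite coord_minus. simpl. unfold seq_sub.
replace (Ci * forcing kappa mu q0 p zeta (coord x) n - Ci * forcing kappa mu q0 p zeta (coord y) n)%C
  with (Ci * (forcing kappa mu q0 p zeta (coord x) n - forcing kappa mu q0 p zeta (coord y) n))%C by ring.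
rewrite Cmod_mult Cmod_Ci. apply Rle_refl.
Qed.

Lemma coord_expA_rhs (t : R) (x : l2) (n : Z) :
  coord (expA A t (l2_rhs x)) n
  = (Ci * exp_lap (kappa * t) (forcing kappa mu q0 p zeta (coord x)) n)%C.
Proof.
unfold l2_rhs. rewrite (expA_comm A (l2_cmul Ci)).
- change (Ci * coord (expA A t (l2_forcing x)) n =
    Ci * exp_lap (kappa * t) (coord (l2_forcing x)) n)%C.
  rewrite exp_lap_expA. reflexivity.
- apply skew_lap_linear.
- apply l2_cmul_linear.
- apply skew_lap_cmul_comm.
Qed.

Lemma coord_duhamel_rhs (t : R) (x x0 : l2) (n : Z) :
  coord (minus x (expA A t x0)) n = Cminus (coord x n) (exp_lap (kappa * t) (coord x0) n).
Proof. rewrite coord_minus exp_lap_expA. reflexivity. Qed.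

Lemma duhamel_of_mild (T : R) (x0 : l2) (Phi : R -> l2) :
  mild A l2_rhs x0 T Phi ->
  duhamel kappa mu q0 p zeta (coord x0) T (fun t => coord (Phi t)).
Proof.
intros H t Ht n. rewrite -coord_duhamel_rhs.
apply (is_RInt_ext (V := C_R_NormedModule)
  (fun s => coord (expA A (t - s) (l2_rhs (Phi s))) n)).
- intros s _. exact (coord_expA_rhs (t - s) (Phi s) n).
- exact (is_RInt_linear _ _ _ _ _ (coord_linear n) (H t Ht)).
Qed.

Lemma l2_rhs_continuous (rho : R) (Phi : R -> l2) (t : R) : (forall s, norm (Phi s) <= rho) ->
  continuous Phi t -> continuous (fun s => l2_rhs (Phi s)) t.
Proof.
intros Hb Hc.
apply (lipschitz_ball_continuous (V := l2_CompleteNormedModule) l2_rhs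
  (lip_const mu q0 p (rho + m)) rho); [|exact Hb|exact Hc].
intros x y. apply l2_rhs_lipschitz.
Qed.

(** Scalar integrals alone give no l^2 integral. Continuity of Phi provides one, and uniqueness of
    the integral at each site identifies its value. *)
Lemma mild_of_duhamel (T rho : R) (x0 : l2) (Phi : R -> l2) :
  (forall t, continuous Phi t) -> (forall t, norm (Phi t) <= rho) ->
  duhamel kappa mu q0 p zeta (coord x0) T (fun t => coord (Phi t)) ->
  mild A l2_rhs x0 T Phi.
Proof.
intros Hc Hb H t Ht.
assert (HI := is_RInt_duhamelA A (fun s => l2_rhs (Phi s)) t (skew_lap_skew kappa)
  (fun s => l2_rhs_continuous rho Phi s Hb (Hc s))).
refine (eq_ind _ (is_RInt (V := l2_NormedModule) _ 0 t) HI _ _).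
apply l2_eq. intros n. rewrite coord_duhamel_rhs.
rewrite -(is_RInt_unique (V := C_R_CompleteNormedModule) _ _ _ _ (H t Ht n)). symmetry.
apply (is_RInt_unique (V := C_R_CompleteNormedModule)).
apply (is_RInt_ext (V := C_R_NormedModule)
  (fun s => coord (expA A (t - s) (l2_rhs (Phi s))) n)).
- intros s _. exact (coord_expA_rhs (t - s) (Phi s) n).
- exact (is_RInt_linear _ _ _ _ _ (coord_linear n) HI).
Qed.

(** * The radius and the lifespan condition *)

Lemma radius_ge_0 (phi0 : zseq) (T : R) : 0 <= T -> 0 <= radius kappa mu q0 p zeta phi0 T.
Proof.
intros HT. unfold radius.
assert (H1 := ell2_norm_ge_0 phi0). assert (H2 := ell2_norm_ge_0 (bdiff zeta)).
apply Rmult_le_pos; [lra|]. repeat apply Rplus_le_le_0_compat; [exact H1| |].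
- repeat apply Rmult_le_pos; try apply sqrt_pos; exact H2.
- apply Rmult_le_pos; [|exact HT]. apply Rmult_le_pos; [apply Rabs_pos|].
  apply Rplus_le_le_0_compat; repeat apply Rmult_le_pos; try apply rpow_ge_0; lra.
Qed.

Lemma radius_mono (phi0 : zseq) (T S : R) : 0 <= T <= S ->
  radius kappa mu q0 p zeta phi0 T <= radius kappa mu q0 p zeta phi0 S.
Proof.
intros [HT HTS]. unfold radius. assert (H2 := ell2_norm_ge_0 (bdiff zeta)).
apply Rmult_le_compat_l; [lra|]. apply Rplus_le_compat; [apply Rplus_le_compat_l|].
- apply Rmult_le_compat_l; [|apply sqrt_le_1; lra].
  apply Rmult_le_pos; [apply sqrt_pos|exact H2].
- apply Rmult_le_compat_l; [|exact HTS]. apply Rmult_le_pos; [apply Rabs_pos|].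
  apply Rplus_le_le_0_compat; repeat apply Rmult_le_pos; try apply rpow_ge_0; lra.
Qed.

Lemma lifespan_lip (phi0 : zseq) (T : R) : 0 < T ->
  lifespan_cond kappa mu q0 p zeta phi0 T ->
  lip_const mu q0 p (radius kappa mu q0 p zeta phi0 T + m) * T <= 1 / 8.
Proof.
intros HT H. unfold lifespan_cond in H. fold m in H. unfold lip_const.
set (a := rpow q0 (2 * p)) in *.
set (b := rpow (radius kappa mu q0 p zeta phi0 T + m) (2 * p)) in *.
assert (Ha : 0 <= a) by apply rpow_ge_0. assert (Hb : 0 <= b) by apply rpow_ge_0.
assert (Hmu := Rabs_pos mu).
assert (Hpw : forall s, 0 <= s -> 1 <= rpow 2 s).
{ intros s Hs. unfold rpow. destruct Rlt_dec; [|lra].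
  rewrite -(Rpower_O 2); [|lra]. apply Rle_Rpower; lra. }
(* The constants enter through 2^(7/2) >= 2^3 and 2^(2p+1/2) >= 1. *)
assert (H8 : 8 <= rpow 2 (7 / 2)).
{ replace (7 / 2) with (1 / 2 + 1 + 1 + 1) by field. rewrite !rpow_S; try lra.
  assert (H0 := Hpw (1 / 2)). lra. }
assert (H1 := Hpw (2 * p + 1 / 2) ltac:(lra)).
set (c := rpow 2 (7 / 2)) in *. set (e := rpow 2 (2 * p + 1 / 2)) in *.
assert (Hpb : 0 <= (2 * p + 1) * b) by (apply Rmult_le_pos; lra).
assert (Hin : a + (2 * p + 1) * b <= a + e * (2 * p + 1) * b).
{ apply Rplus_le_compat_l. rewrite Rmult_assoc -{1}[(2 * p + 1) * b]Rmult_1_l.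
  apply Rmult_le_compat_r; assumption. }
assert (Hm1 : Rabs mu * (a + (2 * p + 1) * b) * T <= Rabs mu * (a + e * (2 * p + 1) * b) * T).
{ apply Rmult_le_compat_r; [lra|]. apply Rmult_le_compat_l; assumption. }
assert (Hm2 : 0 <= Rabs mu * (a + e * (2 * p + 1) * b) * T).
{ apply Rmult_le_pos; [apply Rmult_le_pos|]; lra. }
assert (Hm3 : 8 * (Rabs mu * (a + e * (2 * p + 1) * b) * T) <=
  c * (Rabs mu * (a + e * (2 * p + 1) * b) * T)) by (apply Rmult_le_compat_r; assumption).
lra.
Qed.

Lemma lip_const_ge_0 (rho : R) : 0 <= lip_const mu q0 p rho.
Proof.
apply Rmult_le_pos; [apply Rabs_pos|].
apply Rplus_le_le_0_compat; [|apply Rmult_le_pos; [lra|]]; apply rpow_ge_0.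
Qed.

(** The condition is implicit, as the radius depends on T. For T <= 1 monotonicity replaces the
    radius by its value at 1, and T = 1 / (g + 1) then solves an explicit inequality. *)
Lemma lifespan_exists (phi0 : zseq) :
  exists T, 0 < T /\ lifespan_cond kappa mu q0 p zeta phi0 T.
Proof.
pose (g := fun rho => rpow 2 (7 / 2) * Rabs mu
  * (rpow q0 (2 * p) + rpow 2 (2 * p + 1 / 2) * (2 * p + 1) * rpow (rho + m) (2 * p))).
pose (rho1 := radius kappa mu q0 p zeta phi0 1).
assert (Hg : 0 <= g rho1).
{ unfold g. apply Rmult_le_pos; [apply Rmult_le_pos; [apply rpow_ge_0|apply Rabs_pos]|].
  apply Rplus_le_le_0_compat; repeat apply Rmult_le_pos; try apply rpow_ge_0; lra. }
exists (/ (g rho1 + 1)). assert (HT : 0 < / (g rho1 + 1)) by (apply Rinv_0_lt_compat; lra).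
assert (HT1 : / (g rho1 + 1) <= 1) by (rewrite -Rinv_1; apply Rinv_le_contravar; lra).
split; [exact HT|].
set (T := / (g rho1 + 1)) in *.
change (g (radius kappa mu q0 p zeta phi0 T) * T <= 1).
apply Rle_trans with (g rho1 * T).
- apply Rmult_le_compat_r; [lra|]. unfold g.
  apply Rmult_le_compat_l; [apply Rmult_le_pos; [apply rpow_ge_0|apply Rabs_pos]|].
  apply Rplus_le_compat_l, Rmult_le_compat_l; [apply Rmult_le_pos; [apply rpow_ge_0|lra]|].
  apply rpow_le; [lra|]. apply Rplus_le_compat_r, radius_mono. lra.
- unfold T. apply Rmult_le_reg_r with (g rho1 + 1); [lra|].
  rewrite Rmult_assoc Rinv_l; lra.
Qed.

(** Where the terms of the radius come from: isometry on the data, the sqrt t estimate for i kappa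
    Delta zeta, and the linear bound for the rest of forcing(0). *)
Lemma duhamel_background_norm (x0 : l2) (T t : R) : 0 <= t <= T ->
  norm (plus (expA A t x0) (duhamelA A (fun _ => l2_rhs zero) t))
  <= radius kappa mu q0 p zeta (coord x0) T / 2.
Proof.
intros Ht. assert (HA := skew_lap_skew kappa).
pose (z := exist _ _ zeta_diff : l2).
pose (g1 := l2_cmul Ci (exist _ _ (proj1 nonlin_background_l2le))).
assert (Hg1 : norm g1 <= nl0).
{ rewrite -[X in _ <= X]Rmult_1_l l2_normE.
  refine (proj2 (l2le_dom _ (nonlin mu q0 p zeta) _ _ _ nonlin_background_l2le _)); [lra|].
  intros n. simpl. rewrite Cmod_mult Cmod_Ci. apply Rle_refl. }
replace (l2_rhs zero) with (plus (skew_fdiff kappa z) g1).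
2:{ apply l2_eq. intros n. rewrite coord_plus. simpl.
    change (forcing kappa mu q0 p zeta (fun _ : Z => RtoC 0) n)
      with (forcing kappa mu q0 p zeta (coord zero) n).
    rewrite forcing_zero. ring. }
rewrite (duhamelA_plus A HA (fun _ => skew_fdiff kappa z) (fun _ => g1));
  [|intros s; apply continuous_const|intros s; apply continuous_const].
assert (H1 := duhamelA_fdiff_norm kappa t z kappa_pos (proj1 Ht)).
assert (H2 : norm (duhamelA A (fun _ => g1) t) <= t * nl0).
{ apply (is_RInt_duhamel_norm A (fun _ => g1) t); [exact HA|apply Ht|intros s _; exact Hg1|].
  apply (is_RInt_duhamelA A (fun _ => g1)); [exact HA|intros s; apply continuous_const]. }
eapply Rle_trans; [apply: norm_triangle|].
eapply Rle_trans; [apply Rplus_le_compat_l; apply: norm_triangle|].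
eapply Rle_trans; [apply Rplus_le_compat; [right; exact (expA_norm A t x0 HA)|
  apply Rplus_le_compat; [exact H1|exact H2]]|].
unfold radius. fold m dn. rewrite !l2_normE. change (coord z) with (bdiff zeta). fold dn.
assert (Hdn : 0 <= dn) by apply ell2_norm_ge_0.
assert (Hsq : sqrt t <= sqrt T) by (apply sqrt_le_1; lra).
assert (H3 : sqrt (2 * kappa) * dn * sqrt t <= sqrt (2 * kappa) * dn * sqrt T).
{ apply Rmult_le_compat_l; [apply Rmult_le_pos; [apply sqrt_pos|exact Hdn]|exact Hsq]. }
set (s := rpow (m + q0 + ell2_norm (modulus_defect q0 zeta)) (2 * p + 1)) in *.
set (a := rpow q0 (2 * p)) in *.
set (k := rpow 2 (2 * (p + 2))).
assert (Hs : 0 <= s) by apply rpow_ge_0. assert (Ha : 0 <= a) by apply rpow_ge_0.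
assert (Hk : 2 <= k).
{ unfold k, rpow. destruct Rlt_dec; [|lra]. rewrite -{1}(Rpower_1 2); [|lra].
  apply Rle_Rpower; lra. }
assert (Hps : 0 <= p * s) by (apply Rmult_le_pos; lra).
assert (Had : 0 <= a * dn) by (apply Rmult_le_pos; assumption).
assert (Hin : 2 * p * s + a * dn <= k * p * s + 2 * a * dn).
{ apply Rplus_le_compat; [|lra]. rewrite !Rmult_assoc. apply Rmult_le_compat_r; assumption. }
assert (H4 : nl0 <= Rabs mu * (k * p * s + 2 * a * dn)).
{ unfold nl0. fold s a. apply Rmult_le_compat_l; [apply Rabs_pos|exact Hin]. }
assert (H5 : 0 <= nl0) by apply (l2le_ge_0 _ _ nonlin_background_l2le).
assert (H6 : t * nl0 <= Rabs mu * (k * p * s + 2 * a * dn) * T).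
{ rewrite Rmult_comm. apply Rmult_le_compat; lra. }
lra.
Qed.

(** * Existence and stability in the ball *)

Lemma ball_solution_exists (x0 : l2) (T : R) : 0 < T ->
  lifespan_cond kappa mu q0 p zeta (coord x0) T ->
  exists phi, ball_solution kappa mu q0 p zeta (coord x0) T phi.
Proof.
intros HT HL. assert (HA := skew_lap_skew kappa).
assert (HLT := lifespan_lip _ _ HT HL).
set (rho := radius kappa mu q0 p zeta (coord x0) T) in *.
assert (Hrho : 0 <= rho) by (apply radius_ge_0; lra).
destruct (mild_exists A l2_rhs (lip_const mu q0 p (rho + m)) rho T x0 HA HT Hrho) as [Phi [Hc [Hb Hm]]].
- apply lip_const_ge_0.
- lra.
- intros x y. apply l2_rhs_lipschitz.
- intros t Ht. eapply Rle_trans; [apply Rplus_le_compat_r, (duhamel_background_norm x0 T t Ht)|].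
  (* rho / 2 + L T rho <= rho / 2 + rho / 8 <= rho. *)
  fold rho. apply Rmult_le_compat_r with (r := rho) in HLT; [|exact Hrho]. lra.
- exists (fun t => coord (Phi t)). split; [split|split; [|split]].
  + apply cont_ell2_coord, Hc.
  + apply (Lub_Rbar_real_bounds _ (ell2_norm (coord (Phi 0)))).
    * exists 0. split; [lra|reflexivity].
    * intros y [t [Ht ->]]. apply Hb.
  + apply duhamel_of_mild, Hm.
  (* At t = 0 the integral is over a point, so the Duhamel equation reduces to the initial
     condition. *)
  + intros n. assert (H0 := Hm 0 ltac:(lra)).
    assert (E := is_RInt_unique _ _ _ _ H0).
    rewrite RInt_point in E. symmetry in E. apply (minus_eq_zero_inv (V := l2_NormedModule)) in E.
    rewrite E expA_0; [reflexivity|apply skew_lap_linear].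
  + intros t _. apply ell2_seq_lim_0, coord_ell2.
Qed.

Lemma ball_solution_stable (x0 y0 : l2) (T : R) (phi psi : R -> zseq) : 0 < T ->
  lifespan_cond kappa mu q0 p zeta (coord x0) T ->
  lifespan_cond kappa mu q0 p zeta (coord y0) T ->
  ball_solution kappa mu q0 p zeta (coord x0) T phi ->
  ball_solution kappa mu q0 p zeta (coord y0) T psi ->
  forall t, 0 <= t <= T ->
    l2le (seq_sub (phi t) (psi t)) (2 * ell2_norm (seq_sub (coord x0) (coord y0))).
Proof.
intros HT HL1 HL2 [Hball1 [Hd1 _]] [Hball2 [Hd2 _]].
apply lifespan_lip in HL1; [|exact HT]. apply lifespan_lip in HL2; [|exact HT].
destruct (closed_ball_lift _ _ _ HT Hball1) as [Phi [Hc1 [Hb1 HP1]]].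
destruct (closed_ball_lift _ _ _ HT Hball2) as [Psi [Hc2 [Hb2 HP2]]].
set (r1 := radius kappa mu q0 p zeta (coord x0) T) in *.
set (r2 := radius kappa mu q0 p zeta (coord y0) T) in *.
(* Whichever radius is larger, its own lifespan condition bounds the Lipschitz constant on that
   ball. *)
pose (rho := Rmax r1 r2).
assert (HLT : lip_const mu q0 p (rho + m) * T <= 1 / 2).
{ unfold rho, Rmax. destruct Rle_dec; lra. }
assert (Hext : forall (u : zseq) (chi : R -> zseq) (Chi : R -> l2),
  (forall t, 0 <= t <= T -> coord (Chi t) = chi t) ->
  duhamel kappa mu q0 p zeta u T chi ->
  duhamel kappa mu q0 p zeta u T (fun t => coord (Chi t))).
{ intros u chi Chi HC Hdu t Ht n. rewrite (HC t Ht).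
  eapply is_RInt_ext; [|exact (Hdu t Ht n)].
  intros s. rewrite Rmin_left; [|lra]. rewrite Rmax_right; [|lra].
  intros Hs. rewrite HC; [reflexivity|lra]. }
assert (Hm1 := mild_of_duhamel T r1 x0 Phi Hc1 Hb1 (Hext _ _ _ HP1 Hd1)).
assert (Hm2 := mild_of_duhamel T r2 y0 Psi Hc2 Hb2 (Hext _ _ _ HP2 Hd2)).
intros t Ht.
assert (H := mild_stable A l2_rhs (lip_const mu q0 p (rho + m)) rho T x0 y0 Phi Psi
  (skew_lap_skew kappa) HT (lip_const_ge_0 _) HLT
  (fun x y => l2_rhs_lipschitz rho x y)
  (fun t _ => Rle_trans _ _ _ (Hb1 t) (Rmax_l r1 r2))
  (fun t _ => Rle_trans _ _ _ (Hb2 t) (Rmax_r r1 r2)) Hm1 Hm2 t Ht).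
assert (E : forall x y : l2, coord (minus x y) = seq_sub (coord x) (coord y)).
{ intros x y. apply functional_extensionality. intros n. apply coord_minus. }
rewrite -(HP1 t Ht) -(HP2 t Ht) -!E. split; [apply coord_ell2|exact H].
Qed.

End Equation.

Theorem theorem2p2 (kappa mu q0 p : R) (zeta : zseq) (zeta_p zeta_m : C)
  (kappa_pos : 0 < kappa) (q0_pos : 0 < q0) (p_ge1 : 1 <= p)
  (zeta_X1 : X1 zeta)
  (zeta_lim_p : seq_lim_pinf zeta zeta_p) (zeta_lim_m : seq_lim_minf zeta zeta_m)
  (mod_p : Cmod zeta_p = q0) (mod_m : Cmod zeta_m = q0)
  (zeta_defect : ell2 (modulus_defect q0 zeta)) :
  (forall phi0 : zseq, ell2 phi0 ->
     (exists T : R, 0 < T /\ lifespan_cond kappa mu q0 p zeta phi0 T) /\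
     (forall T : R, 0 < T -> lifespan_cond kappa mu q0 p zeta phi0 T ->
        exists phi : R -> zseq,
          ball_solution kappa mu q0 p zeta phi0 T phi /\
          forall psi : R -> zseq, ball_solution kappa mu q0 p zeta phi0 T psi ->
            forall t, 0 <= t <= T -> forall n, psi t n = phi t n))
  /\
  (forall T : R, 0 < T ->
   forall (phi0 : zseq) (phi : R -> zseq),
     ell2 phi0 -> lifespan_cond kappa mu q0 p zeta phi0 T ->
     ball_solution kappa mu q0 p zeta phi0 T phi ->
     forall eps : R, 0 < eps ->
     exists delta : R, 0 < delta /\
       forall (psi0 : zseq) (psi : R -> zseq),
         ell2 psi0 -> lifespan_cond kappa mu q0 p zeta psi0 T ->
         ball_solution kappa mu q0 p zeta psi0 T psi ->
         ell2_norm (seq_sub psi0 phi0) < delta ->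
         sup_norm T (fun t => seq_sub (psi t) (phi t)) < eps).
Proof.
destruct zeta_X1 as [zeta_inf zeta_diff]. split.
- intros phi0 Hphi0. split; [apply lifespan_exists; assumption|].
  intros T HT HL. pose (x0 := exist _ phi0 Hphi0 : l2).
  destruct (ball_solution_exists kappa mu q0 p zeta kappa_pos q0_pos p_ge1 zeta_inf zeta_diff
    zeta_defect x0 T HT HL) as [phi Hphi].
  exists phi. split; [exact Hphi|]. intros psi Hpsi t Ht n.
  assert (H := ball_solution_stable kappa mu q0 p zeta q0_pos p_ge1 zeta_inf zeta_diff
    zeta_defect x0 x0 T psi phi HT HL HL Hpsi Hphi t Ht).
  (* Uniqueness is stability with equal data. *)
  assert (H0 : ell2_norm (seq_sub (coord x0) (coord x0)) <= 0).
  { refine (proj2 (l2le_mono _ 0 0 _ (Rle_refl 0))).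
    replace (seq_sub (coord x0) (coord x0)) with (fun _ : Z => RtoC 0); [apply l2le_0|].
    apply functional_extensionality. intros k. unfold seq_sub. ring. }
  apply (l2le_coord _ _ n) in H.
  assert (E : (psi t n - phi t n)%C = RtoC 0).
  { apply Cmod_eq_0, Rle_antisym; [|apply Cmod_ge_0].
    eapply Rle_trans; [exact H|]. lra. }
  replace (psi t n) with (psi t n - phi t n + phi t n)%C by ring. rewrite E. ring.
(* delta = eps / 2 because the flow is Lipschitz in the data with constant 2. *)
- intros T HT phi0 phi Hphi0 HL Hphi eps Heps. exists (eps / 2). split; [lra|].
  intros psi0 psi Hpsi0 HL' Hpsi Hd.
  assert (H := ball_solution_stable kappa mu q0 p zeta q0_pos p_ge1 zeta_inf zeta_diff
    zeta_defect (exist _ psi0 Hpsi0) (exist _ phi0 Hphi0) T psi phi HT HL' HL Hpsi Hphi).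
  apply Rle_lt_trans with (2 * ell2_norm (seq_sub psi0 phi0)); [|lra].
  apply (Lub_Rbar_real_bounds _ (ell2_norm (seq_sub (psi 0) (phi 0)))).
  + exists 0. split; [lra|reflexivity].
  + intros y [t [Ht ->]]. apply (H t Ht).
Qed.
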